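(* For any $\alpha\in(\frac13,\frac12)$ there exists a sequence $\{u_n\}\subset\mathring{\mathcal M}_1$ such that $$\log \fint_{\mathbb S^2}e^{2u_n}\,dV-\alpha\fint_{\mathbb S^2}|\nabla u_n|^2\,dV-2\fint_{\mathbb S^2}u_n\,dV\to+\infty\quad\text{and}\quad \|\Lambda(u_n)\|^2\to\frac23 .$$ Similarly, for any $\alpha\in(\frac14,\frac13)$ there exists a sequence $\{u_n\}\subset\mathring{\mathcal M}_1$ such that $$\log \fint_{\mathbb S^2}e^{2u_n}\,dV-\alpha\fint_{\mathbb S^2}|\nabla u_n|^2\,dV-2\fint_{\mathbb S^2}u_n\,dV\to+\infty\quad\text{and}\quad \|\Lambda(u_n)\|^2\to\frac16 .$$
   Context: $\mathbb S^2\subset\mathbb R^3$ is the unit sphere with its standard round metric and area measure $dV$; $x_1,x_2,x_3$ are the coordinate functions of $\mathbb R^3$ restricted to $\mathbb S^2$; $\fint_{\mathbb S^2}f\,dV=\frac1{4\pi}\int_{\mathbb S^2}f\,dV$. Define $$\mathring{\mathcal M}_1=\Big\{u\in H^1(\mathbb S^2):\ \int_{\mathbb S^2}x_ie^{2u}\,dV=0\text{ for }i=1,2,3\Big\}.$$ For $u\in H^1(\mathbb S^2)$ let $\Lambda(u)=(\Lambda_{ij})_{1\le i,j\le3}$ with $$\Lambda_{ij}=\frac{\int_{\mathbb S^2}e^{2u}\left(x_ix_j-\frac13\delta_{ij}\right)dV}{\int_{\mathbb S^2}e^{2u}\,dV},\qquad \|\Lambda\|=\Big(\sum_{i,j=1}^3\Lambda_{ij}^2\Big)^{1/2}.$$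 *)

(* Defs.v *)
From HB Require Import structures.
From mathcomp Require Import all_boot all_order all_algebra.
From mathcomp Require Import all_classical all_reals all_analysis.
From mathcomp Require Import measurable_realfun.

Set Implicit Arguments.
Unset Strict Implicit.
Unset Printing Implicit Defensive.

Import Order.TTheory GRing.Theory Num.Theory.
Import numFieldNormedType.Exports.

Local Open Scope classical_set_scope.
Local Open Scope ring_scope.

Definition rV_display : measure_display.
Proof. exact: default_measure_display. Qed.

(* R^n carries the product sigma-algebra, i.e. the one generated by the
   coordinate functions, which is the Borel sigma-algebra; this is the same
   construction as the library's sigma-algebra on n.-tuple T. *)
Section measurable_rV.
Context (R : realType) (n : nat).

Let coord_rV (i : 'I_n) (x : 'rV[R]_n) : R := x ord0 i.

Let rV_set0 : g_sigma_preimage coord_rV set0.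
Proof. exact: sigma_algebra0. Qed.

Let rV_setC A : g_sigma_preimage coord_rV A -> g_sigma_preimage coord_rV (~` A).
Proof. exact: sigma_algebraC. Qed.

Let rV_bigcup (F : (set 'rV[R]_n)^nat) :
  (forall i, g_sigma_preimage coord_rV (F i)) ->
  g_sigma_preimage coord_rV (\bigcup_i (F i)).
Proof. exact: sigma_algebra_bigcup. Qed.

HB.instance Definition _ := @isMeasurable.Build rV_display 'rV[R]_n
  (g_sigma_preimage coord_rV) rV_set0 rV_setC rV_bigcup.

Lemma measurable_coord_rV (i : 'I_n) :
  measurable_fun [set: 'rV[R]_n] (fun x : 'rV[R]_n => x ord0 i).
Proof.
move=> _ Y mY; rewrite setTI; apply: sub_sigma_algebra => /=.
rewrite -bigcup_seq/=; exists i => /=; first by rewrite mem_index_enum.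
by exists Y => //; rewrite setTI.
Qed.

Lemma measurable_fun_rV (d : measure_display) (T : measurableType d)
    (f : T -> 'rV[R]_n) :
  (forall i, measurable_fun [set: T] (fun t => f t ord0 i)) ->
  measurable_fun [set: T] f.
Proof.
move=> mf _ A mA.
have : g_sigma_preimage (fun i => coord_rV i \o f) `<=` measurable.
  apply: smallest_sub; first exact: sigma_algebra_measurable.
  rewrite -bigcup_seq; apply: bigcup_sub => i _.
  by move=> _ [B mB <-]; exact: mf.
by rewrite g_sigma_preimage_comp; apply; exists A.
Qed.

End measurable_rV.

Section sphere.
Context (R : realType).
Local Notation mu := (@lebesgue_measure R).

Definition dotv (x y : 'rV[R]_3) : R := \sum_(i < 3) x ord0 i * y ord0 i.

Definition sphere : set 'rV[R]_3 := [set x | dotv x x = 1].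

(* p = (polar angle, azimuth) *)
Definition spherical (p : R * R) : 'rV[R]_3 :=
  \row_(i < 3) [:: sin p.1 * cos p.2; sin p.1 * sin p.2; cos p.1]`_i.

Definition angles : set (R * R) := `[0, pi] `*` `[0, 2 * pi].

Lemma measurable_spherical : measurable_fun [set: R * R] spherical.
Proof.
have m1 (f : R -> R) : continuous f ->
    measurable_fun [set: R * R] (fun p => f p.1).
  move=> cf; apply: (@measurableT_comp _ _ _ _ _ _ f _ fst) => //.
  exact: continuous_measurable_fun.
have m2 (f : R -> R) : continuous f ->
    measurable_fun [set: R * R] (fun p => f p.2).
  move=> cf; apply: (@measurableT_comp _ _ _ _ _ _ f _ snd) => //.
  exact: continuous_measurable_fun.
apply: measurable_fun_rV => -[[|[|[|//]]] i3];
  under eq_fun do rewrite mxE /=.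
- apply: measurable_funM; [exact: m1 _ (@continuous_sin R)|exact: m2 _ (@continuous_cos R)].
- apply: measurable_funM; [exact: m1 _ (@continuous_sin R)|exact: m2 _ (@continuous_sin R)].
- exact: m1 _ (@continuous_cos R).
Qed.

Lemma measurable_angles : measurable angles.
Proof. by apply: measurableX; exact: measurable_itv. Qed.

(* The area measure of the round unit sphere, in spherical coordinates
   dV = sin(theta) dtheta dphi, as a measure on R^3 carried by the sphere. *)
Definition sphere_area (A : set 'rV[R]_3) : \bar R :=
  (\int[mu \x mu]_(p in angles `&` spherical @^-1` A) (sin p.1)%:E)%E.

Let mpre (A : set 'rV[R]_3) :
  measurable A -> measurable (angles `&` spherical @^-1` A).
Proof.
move=> mA; apply: measurableI; first exact: measurable_angles.
by rewrite -[X in measurable X]setTI; exact: measurable_spherical.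
Qed.

Let sin_angles_ge0 (p : R * R) : angles p -> (0 <= (sin p.1)%:E)%E.
Proof.
by case=> /=; rewrite in_itv/= => p1 _; rewrite lee_fin sin_ge0_pi.
Qed.

Let measurable_sin_fst : measurable_fun [set: R * R] (fun p => sin p.1 : R).
Proof.
apply: (@measurableT_comp _ _ _ _ _ _ (@sin R) _ fst) => //.
exact: continuous_measurable_fun (@continuous_sin R).
Qed.

Let sphere_area0 : sphere_area set0 = 0%E.
Proof. by rewrite /sphere_area preimage_set0 setI0 integral_set0. Qed.

Let sphere_area_ge0 A : (0 <= sphere_area A)%E.
Proof. by apply: integral_ge0 => p [/sin_angles_ge0]. Qed.

Let sphere_area_sigma_additive : semi_sigma_additive sphere_area.
Proof.
move=> /= F mF tF mUF; rewrite /sphere_area preimage_bigcup setI_bigcupr.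
rewrite ge0_integral_bigcup//=; first last.
- apply/trivIsetP => i j _ _ ij.
  rewrite setIACA setIid -preimage_setI.
  by move/trivIsetP : tF => /(_ i j I I ij) ->; rewrite preimage_set0 setI0.
- by move=> p [i _ [/sin_angles_ge0]].
- apply/measurable_EFinP/measurable_funTS.
  exact: measurable_sin_fst.
- by move=> i; exact: mpre.
by apply: is_cvg_ereal_nneg_natsum_cond => // n _ _; exact: sphere_area_ge0.
Qed.

HB.instance Definition _ := isMeasure.Build _ _ _ sphere_area
  sphere_area0 sphere_area_ge0 sphere_area_sigma_additive.

Definition sphere_int (f : 'rV[R]_3 -> R) : R :=
  \int[sphere_area]_(x in sphere) f x.

Definition sphere_mean (f : 'rV[R]_3 -> R) : R := (4 * pi)^-1 * sphere_int f.

Definition pderiv (i : 'I_3) (f : 'rV[R]_3 -> R) : 'rV[R]_3 -> R :=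
  fun x => 'D_(delta_mx ord0 i) f x.

(* C^infinity: all iterated partial derivatives are (Frechet) differentiable.
   The smooth functions on the sphere are the restrictions of these. *)
Definition smooth (f : 'rV[R]_3 -> R) : Prop :=
  forall (s : seq 'I_3) (x : 'rV[R]_3), differentiable (foldr pderiv f s) x.

(* At a point x of the sphere, the gradient for the round metric of the
   restriction of f: the Euclidean gradient projected to the plane
   orthogonal to x. *)
Definition sphere_grad (f : 'rV[R]_3 -> R) (x : 'rV[R]_3) : 'rV[R]_3 :=
  let g := \row_(i < 3) pderiv i f x in g - dotv g x *: x.

Definition sphere_L2 (f : 'rV[R]_3 -> R) : Prop :=
  measurable_fun sphere f /\
  sphere_area.-integrable sphere (fun x => (f x ^+ 2)%:E).

(* H^1 of the sphere as the completion of the smooth functions for the norm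
   (|u|_{L^2}^2 + |grad u|_{L^2}^2)^{1/2}, realized inside L^2: u and the field
   G are the L^2 limits of phi_k and grad phi_k for some smooth phi_k.
   G is determined a.e. by u (the gradient is closable) and is grad u. *)
Definition is_sobolev_grad (u : 'rV[R]_3 -> R) (G : 'rV[R]_3 -> 'rV[R]_3) :=
  [/\ sphere_L2 u,
      forall i : 'I_3, sphere_L2 (fun x => G x ord0 i) &
      exists phi : nat -> 'rV[R]_3 -> R,
      [/\ forall k, smooth (phi k),
          (\int[sphere_area]_(x in sphere)
             ((phi k x - u x) ^+ 2)%:E)%E @[k --> \oo] --> 0%E &
          (\int[sphere_area]_(x in sphere)
             (dotv (sphere_grad (phi k) x - G x)
                   (sphere_grad (phi k) x - G x))%:E)%E @[k --> \oo] --> 0%E]].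

(* Functions on the sphere are total functions on R^3, of which only the
   values on the sphere matter. *)
Record H1_sphere := MkH1Sphere {
  h1_fun :> 'rV[R]_3 -> R ;
  h1_grad : 'rV[R]_3 -> 'rV[R]_3 ;
  h1P : is_sobolev_grad h1_fun h1_grad
}.

Definition M1 : set H1_sphere :=
  [set u | forall i : 'I_3,
     sphere_int (fun x => x ord0 i * expR (2 * u x)) = 0].

Definition Lambda (u : H1_sphere) : 'M[R]_3 :=
  \matrix_(i < 3, j < 3)
    (sphere_int (fun x =>
       expR (2 * u x) * (x ord0 i * x ord0 j - 3^-1 * (i == j)%:R))
     / sphere_int (fun x => expR (2 * u x))).

Definition frobenius (A : 'M[R]_3) : R :=
  Num.sqrt (\sum_(i < 3) \sum_(j < 3) A i j ^+ 2).

Definition J (alpha : R) (u : H1_sphere) : R :=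
  ln (sphere_mean (fun x => expR (2 * u x)))
  - alpha * sphere_mean (fun x => dotv (h1_grad u x) (h1_grad u x))
  - 2 * sphere_mean u.

End sphere.

(* Main.v *)
(* Given unit vectors [a_1, .., a_N], put [y_i = 1 + e - x . a_i] and
   [u = - sum_i ln y_i], which concentrates at the [a_i] as [e] tends to 0. The
   Laplacian of [- ln y_i] is [1 - k / y_i^2] with [k = 2 e + e^2], so the
   divergence theorem on the sphere gives [int k / y_i^2 = 4 pi], hence
   [int e^(2u) >= c / e], and
   [int |grad u|^2 = sum_i int u (k / y_i^2 - 1) <= 4 pi N (ln (1 / e) + C)]
   because [u <= ln (1 / e)]. The mean of [u] being bounded above, the
   functional is at least [(1 - alpha N) ln (1 / e) - C].
   Two antipodal points (N = 2, on the x_3-axis) and an equilateral triangle on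
   the equator (N = 3) both make [u] invariant under [x_3 -> - x_3] and under
   the rotation of angle [2 pi / 3] about the x_3-axis: this forces the center
   of mass to vanish and Lambda to be diag(- m / 2, - m / 2, m), whose squared
   norm is [3 m^2 / 2]. Finally [m] tends to [l - 1 / 3], where [l = 1] for the
   poles and [l = 0] for the triangle, because [|x_3^2 - l| <= e^(- u)]. *)
Require Import Defs.
From mathcomp Require Import all_boot all_order all_algebra.
From mathcomp Require Import all_classical all_reals all_analysis.
From mathcomp Require Import measurable_realfun ring lra.
Set Implicit Arguments.
Unset Strict Implicit.
Unset Printing Implicit Defensive.
Import Order.TTheory GRing.Theory Num.Theory.
Import numFieldNormedType.Exports.

Local Open Scope classical_set_scope.
Local Open Scope ring_scope.

(** * A class of smooth functions given by formulas, and their partial derivatives *)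

Section elementary.
Context (R : realType).
Implicit Types (f g : 'rV[R]_3 -> R) (x v : 'rV[R]_3).

(** Membership in this class is a syntactic certificate: smoothness, continuity and measurability
    all follow by induction on the formula. In [elem_ln] the argument is positive on all of R^3, so
    no domain of definition has to be tracked. *)
Inductive elem : ('rV[R]_3 -> R) -> Prop :=
| elem_cst c : elem (fun=> c)
| elem_coord i : elem (fun x => x ord0 i)
| elemD f g : elem f -> elem g -> elem (fun x => f x + g x)
| elemM f g : elem f -> elem g -> elem (fun x => f x * g x)
| elem_expR f : elem f -> elem (fun x => expR (f x))
| elem_ln f : elem f -> (forall x, 0 < f x) -> elem (fun x => ln (f x)).

Lemma elemN f : elem f -> elem (fun x => - f x).
Proof.
move=> ef; under eq_fun do rewrite -mulN1r.
by apply: elemM => //; exact: elem_cst.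
Qed.

Lemma elemB f g : elem f -> elem g -> elem (fun x => f x - g x).
Proof. by move=> ef eg; apply: elemD => //; exact: elemN. Qed.

(** Writing [1 / f] as [exp (- ln f)] spares a constructor for inverses. *)
Lemma elemV f : elem f -> (forall x, 0 < f x) -> elem (fun x => (f x)^-1).
Proof.
move=> ef f0; rewrite (_ : (fun _ => _) = fun x => expR (- ln (f x))).
  by apply/elem_expR/elemN/elem_ln.
by apply/funext => x; rewrite expRN lnK// posrE.
Qed.

Lemma elemX f n : elem f -> elem (fun x => f x ^+ n).
Proof.
move=> ef; elim: n => [|n ih]; first by under eq_fun do rewrite expr0; exact: elem_cst.
by under eq_fun do rewrite exprS; exact: elemM.
Qed.

Lemma elem_sum (I : Type) (s : seq I) (F : I -> 'rV[R]_3 -> R) :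
  (forall i, elem (F i)) -> elem (fun x => \sum_(i <- s) F i x).
Proof.
move=> eF; elim: s => [|i s ih].
  by under eq_fun do rewrite big_nil; exact: elem_cst.
by under eq_fun do rewrite big_cons; exact: elemD.
Qed.

Lemma elem_differentiable f x : elem f -> differentiable f x.
Proof.
elim=> {f} [c|i|f g _ df _ dg|f g _ df _ dg|f _ df|f _ df f0].
- exact: differentiable_cst.
- exact: differentiable_coord.
- exact: differentiableD.
- exact: differentiableM.
- apply: (@differentiable_comp _ _ _ _ f expR) => //.
  exact/derivable1_diffP/derivable_expR.
- apply: (@differentiable_comp _ _ _ _ f (@ln R)) => //.
  by apply/derivable1_diffP; have [] := is_derive1_ln (f0 x).
Qed.

Lemma diff_derive1 (h : R -> R) (y l dh : R) : is_derive y 1 h dh ->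
  'd h y l = l * dh.
Proof.
move=> hd; rewrite -deriveE; last exact/derivable1_diffP.
have -> : l = l *: 1 by rewrite /GRing.scale /= mulr1.
have dd : differentiable h y by exact/derivable1_diffP.
by rewrite deriveE// linearZ /= -deriveE// (derive_val (is_derive := hd)) /GRing.scale /= mulr1.
Qed.

Lemma derive_comp1 (h : R -> R) f x v (dh : R) : differentiable f x ->
  is_derive (f x) 1 h dh -> 'D_v (fun z => h (f z)) x = dh * 'D_v f x.
Proof.
move=> df hd; have dd : differentiable h (f x) by exact/derivable1_diffP.
rewrite deriveE; last exact: (@differentiable_comp _ _ _ _ f h).
rewrite (_ : (fun z => h (f z)) = h \o f)// diff_comp//=.
by rewrite (diff_derive1 _ hd) mulrC deriveE.
Qed.

Lemma pderiv_cst i c : pderiv i (fun _ : 'rV[R]_3 => c) = fun=> 0.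
Proof. by apply/funext => x; exact: (@derive_cst R). Qed.

Lemma pderiv_coord i j :
  pderiv i (fun x : 'rV[R]_3 => x ord0 j) = fun=> (i == j)%:R.
Proof.
apply/funext => x; rewrite /pderiv deriveE; last exact: differentiable_coord.
have @l : {linear 'rV[R]_3 -> R}.
  by exists (fun N : 'rV[R]_3 => N ord0 j); do 2![eexists]; do ?[constructor];
     rewrite ?mxE// => ? *; rewrite ?mxE//; move=> ?; rewrite !mxE.
rewrite (_ : (fun _ => _) = l) // diff_lin; last exact: coord_continuous.
by rewrite /l /= mxE eqxx /= eq_sym.
Qed.

Lemma pderivD i f g : elem f -> elem g ->
  pderiv i (fun x => f x + g x) = fun x => pderiv i f x + pderiv i g x.
Proof.
move=> ef eg; apply/funext => x.
by apply: deriveD; apply/diff_derivable/elem_differentiable.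
Qed.

Lemma pderivM i f g : elem f -> elem g ->
  pderiv i (fun x => f x * g x) =
  fun x => f x * pderiv i g x + g x * pderiv i f x.
Proof.
move=> ef eg; apply/funext => x.
by apply: deriveM; apply/diff_derivable/elem_differentiable.
Qed.

Lemma pderivV i f : elem f -> (forall x, 0 < f x) ->
  pderiv i (fun x => (f x)^-1) = fun x => - (f x)^-2 * pderiv i f x.
Proof.
move=> ef f0; apply/funext => x.
by rewrite /pderiv [LHS]deriveV ?gt_eqF//; apply/diff_derivable/elem_differentiable.
Qed.

Lemma pderiv_expR i f : elem f ->
  pderiv i (fun x => expR (f x)) = fun x => expR (f x) * pderiv i f x.
Proof.
move=> ef; apply/funext => x.
by apply: derive_comp1; exact: elem_differentiable.
Qed.

Lemma pderiv_ln i f : elem f -> (forall x, 0 < f x) ->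
  pderiv i (fun x => ln (f x)) = fun x => (f x)^-1 * pderiv i f x.
Proof.
move=> ef f0; apply/funext => x.
have dl := is_derive1_ln (f0 x).
by apply: derive_comp1; exact: elem_differentiable.
Qed.

(** Stability under partial derivatives is what turns differentiability of every [elem] function
    into smoothness. *)
Lemma elem_pderiv i f : elem f -> elem (pderiv i f).
Proof.
elim=> {f} [c|j|f g ef df eg dg|f g ef df eg dg|f ef df|f ef df f0].
- by rewrite pderiv_cst; exact: elem_cst.
- by rewrite pderiv_coord; exact: elem_cst.
- by rewrite pderivD//; exact: elemD.
- by rewrite pderivM//; apply: elemD; exact: elemM.
- by rewrite pderiv_expR//; apply: elemM => //; exact: elem_expR.
- rewrite pderiv_ln//; apply: elemM => //; exact: elemV.
Qed.

Lemma elem_smooth f : elem f -> smooth f.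
Proof.
move=> ef s x; apply: elem_differentiable.
by elim: s => //= i s; exact: elem_pderiv.
Qed.

Lemma elem_continuous f : elem f -> continuous f.
Proof. by move=> ef x; apply/differentiable_continuous/elem_differentiable. Qed.

Lemma elem_measurable f : elem f -> measurable_fun [set: 'rV[R]_3] f.
Proof.
elim=> {f} [c|i|f g _ mf _ mg|f g _ mf _ mg|f _ mf|f _ mf f0].
- exact: measurable_cst.
- exact: measurable_coord_rV.
- exact: measurable_funD.
- exact: measurable_funM.
- exact: measurableT_comp.
- by apply: measurableT_comp => //; exact: measurable_ln.
Qed.

Lemma elem_pderiv_sum i (I : Type) (s : seq I) (F : I -> 'rV[R]_3 -> R) :
  (forall j, elem (F j)) ->
  pderiv i (fun x => \sum_(j <- s) F j x) = fun x => \sum_(j <- s) pderiv i (F j) x.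
Proof.
move=> eF; elim: s => [|j s ih].
  under eq_fun do rewrite big_nil.
  by rewrite pderiv_cst; apply/funext => x; rewrite big_nil.
under eq_fun do rewrite big_cons.
rewrite pderivD//; last exact: elem_sum.
by apply/funext => x; rewrite big_cons ih.
Qed.

End elementary.

(** * Change of variables for the image of a measure with density *)

Section integral_image_density.
Context d d' (T : measurableType d) (T' : measurableType d') (R : realType).
Variables (m : {measure set T -> \bar R}) (nu : {measure set T' -> \bar R}).
Variables (D : set T) (phi : T -> T') (w : T -> R).
Hypotheses (mD : measurable D) (mphi : measurable_fun [set: T] phi).
Hypotheses (mw : measurable_fun D w) (w0 : forall x, D x -> 0 <= w x).
Hypothesis nuE : forall A, measurable A ->
  nu A = (\int[m]_(x in D `&` phi @^-1` A) (w x)%:E)%E.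

Local Open Scope ereal_scope.

Let integral_image_density_indic E : measurable E ->
  \int[nu]_y (\1_E y)%:E = \int[m]_(x in D) ((\1_E (phi x))%:E * (w x)%:E).
Proof.
move=> mE; rewrite integral_indic//= setIT nuE// integral_mkcondr.
apply: eq_integral => x _; rewrite patchE indicE.
have -> : (x \in phi @^-1` E) = (phi x \in E) by apply/idP/idP; rewrite !inE.
by case: ifPn => _; rewrite ?mul1e ?mul0e.
Qed.

Import HBNNSimple.

Let mfphi (f : T' -> \bar R) : measurable_fun setT f ->
  measurable_fun D (fun x => f (phi x) * (w x)%:E).
Proof.
move=> mf; apply: emeasurable_funM; last exact/measurable_EFinP.
by apply: measurable_funTS; exact: measurableT_comp.
Qed.

Let integral_image_density_nnsfun (f : {nnsfun T' >-> R}) :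
  \int[nu]_y (f y)%:E = \int[m]_(x in D) ((f (phi x))%:E * (w x)%:E).
Proof.
under [LHS]eq_integral do rewrite fimfunE -fsumEFin//.
rewrite [LHS]ge0_integral_fsum//; last 2 first.
  - by move=> r; exact/measurable_EFinP/measurableT_comp.
  - by move=> n x _; rewrite EFinM nnfun_muleindic_ge0.
under [RHS]eq_integral.
  move=> x xD; rewrite fimfunE -fsumEFin// muleC ge0_mule_fsumr; last first.
    by move=> r; rewrite EFinM nnfun_muleindic_ge0.
  over.
rewrite [RHS]ge0_integral_fsum//; last 2 first.
  - move=> r; under eq_fun do rewrite muleC.
    apply: (mfphi (f := fun y => (r * \1_(f @^-1` [set r]) y)%:E)).
    by apply/measurable_EFinP/measurableT_comp.
  - move=> n x Dx; rewrite mule_ge0// ?lee_fin ?w0//.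
    by rewrite -lee_fin EFinM nnfun_muleindic_ge0.
apply: eq_fsbigr => r _.
rewrite integralZl_indic_nnsfun//= integral_image_density_indic//.
have [r0|r0] := leP 0%R r; last first.
  (* A nonnegative simple function takes no negative value, so both sides vanish. *)
  rewrite (_ : f @^-1` [set r] = set0); last exact: preimage_nnfun0.
  transitivity (0 : \bar R).
    by rewrite [X in _ * X]integral0_eq ?mule0// => x _; rewrite indicE in_set0 mul0e.
  by apply/esym/integral0_eq => x _; rewrite indicE in_set0 mulr0 mule0.
rewrite -ge0_integralZl//.
- by apply: eq_integral => x _; rewrite [RHS]muleC EFinM muleA.
- by apply: (mfphi (f := fun y => (\1_(f @^-1` [set r]) y)%:E)); exact/measurable_EFinP.
- by move=> x Dx; rewrite mule_ge0// lee_fin// w0.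
Qed.

(** [nu] is the image under [phi] of the measure with density [w] on [D]. The formula passes from
    indicators to simple functions by linearity, then to [f] by monotone convergence. *)
Lemma ge0_integral_image_density (f : T' -> \bar R) :
  measurable_fun setT f -> (forall y, 0 <= f y) ->
  \int[nu]_y f y = \int[m]_(x in D) (f (phi x) * (w x)%:E).
Proof.
move=> mf f0; pose f_ := nnsfun_approx measurableT mf.
have f_n n : measurable_fun setT (fun x => (f_ n x)%:E) by exact/measurable_EFinP.
transitivity (lim (\int[nu]_y (f_ n y)%:E @[n --> \oo])).
  rewrite -monotone_convergence//=.
  - apply: eq_integral => y _; apply/esym/cvg_lim => //=.
    exact: cvg_nnsfun_approx.
  - by move=> n y _; rewrite lee_fin.
  - by move=> y _ ? ? mn; rewrite lee_fin; exact/lefP/nd_nnsfun_approx.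
rewrite [RHS](_ : _ = lim
    (\int[m]_(x in D) ((f_ n (phi x))%:E * (w x)%:E) @[n --> \oo])).
  by apply: congr_lim; apply/funext => n /=; exact: integral_image_density_nnsfun.
rewrite -monotone_convergence//=.
- apply: eq_integral => x /[!inE] xD; apply/esym/cvg_lim => //=.
  apply: cvgeZr => //; exact: cvg_nnsfun_approx.
- by move=> n; exact: (mfphi (f := fun y => (f_ n y)%:E)).
- by move=> n x Dx; rewrite mule_ge0// lee_fin// w0.
- move=> x Dx p q pq; rewrite lee_wpmul2r ?lee_fin ?w0//.
  exact/lefP/nd_nnsfun_approx.
Qed.

(** As [w >= 0], multiplication by [w] commutes with taking positive and negative parts. *)
Lemma integral_image_density (f : T' -> \bar R) : measurable_fun setT f ->
  \int[nu]_y f y = \int[m]_(x in D) (f (phi x) * (w x)%:E).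
Proof.
move=> mf; rewrite integralE [RHS]integralE.
congr (_ - _).
  rewrite ge0_integral_image_density//; last exact: measurable_funepos.
  apply: eq_integral => x /[!inE] Dx.
  by rewrite !funeposE maxe_pMl ?lee_fin ?w0// mul0e.
rewrite ge0_integral_image_density//; last exact: measurable_funeneg.
apply: eq_integral => x /[!inE] Dx.
by rewrite !funenegE maxe_pMl ?lee_fin ?w0// mul0e mulNe.
Qed.

End integral_image_density.

(** The norm of a row vector is the largest absolute value of its entries, so finitely many
    neighbourhoods, one per coordinate, are intersected. *)
Lemma continuous_rV (R : realType) (T : topologicalType) n (f : T -> 'rV[R]_n) :
  (forall i, continuous (fun t => f t ord0 i)) -> continuous f.
Proof.
move=> cf t; apply/cvgrPdist_le => /= e e0; near=> x.
rewrite [leLHS]/Num.Def.normr/= mx_normrE (bigmax_le _ (ltW e0))//= => i _.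
rewrite !mxE/=; move: i; near: x; apply: filter_forall => /= -[i j].
rewrite (ord1 i); exact: ((cvgrPdist_le _ _).1 (cf j t)).
Unshelve. all: by end_near. Qed.

(** * Fubini's theorem on a rectangle, by extension by zero *)

Section fubini_rectangle.
Context d1 d2 (T1 : measurableType d1) (T2 : measurableType d2) (R : realType).
Variables (m1 : {sigma_finite_measure set T1 -> \bar R}).
Variables (m2 : {sigma_finite_measure set T2 -> \bar R}).
Implicit Types (A : set T1) (B : set T2) (h : T1 * T2 -> R).
Local Open Scope ereal_scope.

Lemma integral12_setX A B h : measurable A -> measurable B ->
  (m1 \x m2).-integrable (A `*` B) (EFin \o h) ->
  \int[m1 \x m2]_(p in A `*` B) (h p)%:E =
  \int[m1]_(x in A) \int[m2]_(y in B) (h (x, y))%:E.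
Proof.
move=> mA mB ih; have mAB : measurable (A `*` B) by exact: measurableX.
rewrite integral_mkcond -integral12_prod_meas1; last first.
  exact: (integrable_mkcond _ mAB).1 ih.
rewrite [RHS]integral_mkcond; apply: eq_integral => x _.
rewrite /fubini_F patchE; case: ifPn => xA; last first.
  apply: integral0_eq => y _; rewrite patchE ifF//.
  by apply/negbTE; rewrite notin_setE => -[/= Ax _]; rewrite notin_setE in xA.
rewrite [RHS]integral_mkcond; apply: eq_integral => y _.
by rewrite !patchE in_setX xA.
Qed.

Lemma integral21_setX A B h : measurable A -> measurable B ->
  (m1 \x m2).-integrable (A `*` B) (EFin \o h) ->
  \int[m1 \x m2]_(p in A `*` B) (h p)%:E =
  \int[m2]_(y in B) \int[m1]_(x in A) (h (x, y))%:E.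
Proof.
move=> mA mB ih; have mAB : measurable (A `*` B) by exact: measurableX.
rewrite integral_mkcond -integral21_prod_meas1; last first.
  exact: (integrable_mkcond _ mAB).1 ih.
rewrite [RHS]integral_mkcond; apply: eq_integral => y _.
rewrite /fubini_G patchE; case: ifPn => yB; last first.
  apply: integral0_eq => x _; rewrite patchE ifF//.
  by apply/negbTE; rewrite notin_setE => -[/= _ By]; rewrite notin_setE in yB.
rewrite [RHS]integral_mkcond; apply: eq_integral => x _.
by rewrite !patchE in_setX yB andbT.
Qed.

End fubini_rectangle.

(** * Integration of continuous functions over the rectangle of angles *)

Section tame.
Context (R : realType).
Local Notation mu := (@lebesgue_measure R).
Implicit Types (h k : R * R -> R).

(** Continuity bounds [h] on the compact rectangle of angles and feeds the one-variable calculus on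
    sections; measurability is for the product sigma-algebra. Together they give integrability. *)
Definition tame h := continuous h /\ measurable_fun [set: R * R] h.

Lemma tameD h k : tame h -> tame k -> tame (fun p => h p + k p).
Proof.
move=> [ch mh] [ck mk]; split; last exact: measurable_funD.
by move=> x; apply: cvgD; [exact: ch|exact: ck].
Qed.

Lemma tameM h k : tame h -> tame k -> tame (fun p => h p * k p).
Proof.
move=> [ch mh] [ck mk]; split; last exact: measurable_funM.
by move=> x; apply: cvgM; [exact: ch|exact: ck].
Qed.

Lemma tame_cst c : tame (fun=> c).
Proof. by split; [move=> x; exact: cvg_cst|exact: measurable_cst]. Qed.

Lemma tameN h : tame h -> tame (fun p => - h p).
Proof.
by move=> th; under eq_fun do rewrite -mulN1r; apply: tameM => //; exact: tame_cst.
Qed.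

Lemma tame_fst (g : R -> R) : continuous g -> tame (fun p => g p.1).
Proof.
move=> cg; split.
  by move=> x; apply: (@continuous_comp _ _ _ fst g) => //; [exact: cvg_fst|exact: cg].
apply: (@measurableT_comp _ _ _ _ _ _ g _ fst) => //.
exact: continuous_measurable_fun.
Qed.

Lemma tame_snd (g : R -> R) : continuous g -> tame (fun p => g p.2).
Proof.
move=> cg; split.
  by move=> x; apply: (@continuous_comp _ _ _ snd g) => //; [exact: cvg_snd|exact: cg].
apply: (@measurableT_comp _ _ _ _ _ _ g _ snd) => //.
exact: continuous_measurable_fun.
Qed.

Lemma continuous_spherical : continuous (@spherical R).
Proof.
apply: continuous_rV => -[[|[|[|//]]] i3]; under eq_fun do rewrite mxE /=.
- exact: (tameM (tame_fst (@continuous_sin R)) (tame_snd (@continuous_cos R))).1.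
- exact: (tameM (tame_fst (@continuous_sin R)) (tame_snd (@continuous_sin R))).1.
- exact: (tame_fst (@continuous_cos R)).1.
Qed.

Lemma tame_elem f : elem f -> tame (fun p => f (@spherical R p)).
Proof.
move=> ef; split.
  move=> x; apply: (@continuous_comp _ _ _ (@spherical R) f).
    exact: continuous_spherical.
  exact: (elem_continuous ef).
apply: (@measurableT_comp _ _ _ _ _ _ f _ (@spherical R)) => //.
  exact: elem_measurable.
exact: measurable_spherical.
Qed.

Lemma tame_section1 h y : tame h -> continuous (fun x => h (x, y)).
Proof.
move=> [ch _] x; apply: (@continuous_comp _ _ _ (fun x => (x, y)) h) => //.
  by apply: (@cvg_pair _ _ _ _ (nbhs x) (nbhs y)); [exact: cvg_id|exact: cvg_cst].
exact: ch.
Qed.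

Lemma tame_section2 h x : tame h -> continuous (fun y => h (x, y)).
Proof.
move=> [ch _] y; apply: (@continuous_comp _ _ _ (fun y => (x, y)) h) => //.
  by apply: (@cvg_pair _ _ _ _ (nbhs x) (nbhs y)); [exact: cvg_cst|exact: cvg_id].
exact: ch.
Qed.

Lemma tame_integrable h : tame h ->
  ((mu \x mu).-integrable (@angles R) (EFin \o h))%E.
Proof.
move=> [ch mh]; apply: measurable_bounded_integrable => //.
- exact: measurable_angles.
- have := @product_measure1E _ _ _ _ R mu mu `[0, pi] `[0, 2 * pi]
    (measurable_itv _) (measurable_itv _).
  move=> /= ->; rewrite !lebesgue_measure_itv/=.
  by do 2 case: ifP => _; rewrite ?mule0 ?mul0e -?EFinB -?EFinM ?ltry.
- exact: measurable_funTS.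
- have : compact (h @` @angles R).
    apply: continuous_compact; first exact: continuous_subspaceT.
    by apply: compact_setX; exact: segment_compact.
  move=> /compact_bounded[M [Mr HM]]; exists M; split => // x Mx p ap.
  by apply: (HM _ Mx); exists p.
Qed.

Lemma itv_integral_derive (g G : R -> R) (a b : R) : a < b -> continuous g ->
  (forall x : R, is_derive x 1 G (g x)) ->
  (\int[mu]_(x in `[a, b]) (g x)%:E = (G b - G a)%:E)%E.
Proof.
move=> ab cg dG; rewrite EFinB; apply: continuous_FTC2 => //.
- exact: continuous_subspaceT.
- have cG : continuous G.
    move=> x; apply: differentiable_continuous.
    by apply/derivable1_diffP; have [] := dG x.
  split.
  + by move=> x _; have [] := dG x.
  + by apply: cvg_at_right_filter; exact: cG.
  + by apply: cvg_at_left_filter; exact: cG.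
- by move=> x _; rewrite derive1E; have [_ ->] := dG x.
Qed.

(** The integration in [theta] is carried out first: by the fundamental theorem of calculus it gives
    the difference of two equal boundary values. *)
Lemma tame_integral_dtheta h G : tame h ->
  (forall x y : R, is_derive x 1 (fun t => G (t, y)) (h (x, y))) ->
  (forall y, G (0, y) = G (pi, y)) ->
  (\int[mu \x mu]_(p in @angles R) (h p)%:E = 0)%E.
Proof.
move=> th dG G0; rewrite integral21_setX//; last exact: tame_integrable.
apply: integral0_eq => y _.
rewrite (itv_integral_derive (pi_gt0 R) (@tame_section1 h y th) (fun x => dG x y)).
by rewrite G0 subrr.
Qed.

Lemma tame_integral_dphi h G : tame h ->
  (forall x y : R, is_derive y 1 (fun t => G (x, t)) (h (x, y))) ->
  (forall x, G (x, 0) = G (x, 2 * pi)) ->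
  (\int[mu \x mu]_(p in @angles R) (h p)%:E = 0)%E.
Proof.
move=> th dG G0; rewrite integral12_setX//; last exact: tame_integrable.
apply: integral0_eq => x _.
have pi2 : 0 < 2 * pi :> R by rewrite mulr_gt0// pi_gt0.
rewrite (itv_integral_derive pi2 (@tame_section2 h x th) (dG x)).
by rewrite G0 subrr.
Qed.

Lemma tame_integralD h k : tame h -> tame k ->
  (\int[mu \x mu]_(p in @angles R) (h p + k p)%:E =
   \int[mu \x mu]_(p in @angles R) (h p)%:E +
   \int[mu \x mu]_(p in @angles R) (k p)%:E)%E.
Proof.
move=> th tk; under eq_integral do rewrite EFinD.
by rewrite integralD//; [exact: measurable_angles|exact: tame_integrable..].
Qed.

End tame.

(** Literal indices, so that the entries of vectors given by explicit lists reduce by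
    computation. *)
Notation j0 := (@Ordinal 3 0 isT).
Notation j1 := (@Ordinal 3 1 isT).
Notation j2 := (@Ordinal 3 2 isT).

Lemma sum3E (V : nmodType) (F : 'I_3 -> V) :
  \sum_(i < 3) F i = F j0 + F j1 + F j2.
Proof.
rewrite !big_ord_recl big_ord0 addr0 addrA.
by congr (F _ + F _ + F _); exact/val_inj.
Qed.

(** * One-variable derivation rules in pointwise form *)

Section derive1_rules.
Context (R : realType).
Implicit Types (f g : R -> R) (t df dg : R).

Lemma is_derive1D f g t df dg : is_derive t 1 f df -> is_derive t 1 g dg ->
  is_derive t 1 (fun s => f s + g s) (df + dg).
Proof. by move=> hf hg; exact: (is_deriveD hf hg). Qed.

Lemma is_derive1M f g t df dg : is_derive t 1 f df -> is_derive t 1 g dg ->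
  is_derive t 1 (fun s => f s * g s) (f t * dg + g t * df).
Proof. by move=> hf hg; exact: (is_deriveM hf hg). Qed.

Lemma is_derive1N f t df : is_derive t 1 f df ->
  is_derive t 1 (fun s => - f s) (- df).
Proof. by move=> hf; exact: (is_deriveN hf). Qed.

Lemma is_derive1_cst c t : is_derive t 1 (fun=> c : R) 0.
Proof. exact: (is_derive_cst (c : R^o)). Qed.

End derive1_rules.

(** * The integral over the sphere in spherical coordinates *)

Section sphere_integral.
Context (R : realType).
Local Notation mu := (@lebesgue_measure R).
Local Notation sphere := (@sphere R).
Local Notation sphere_area := (@sphere_area R).
Local Notation angles := (@angles R).
Implicit Types (f g : 'rV[R]_3 -> R) (x y a : 'rV[R]_3).

Lemma dotvE x y : dotv x y =
  x ord0 j0 * y ord0 j0 + x ord0 j1 * y ord0 j1 + x ord0 j2 * y ord0 j2.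
Proof. exact: sum3E. Qed.

Lemma elem_dotv (f g : 'rV[R]_3 -> 'rV[R]_3) :
  (forall i, elem (fun x => f x ord0 i)) ->
  (forall i, elem (fun x => g x ord0 i)) -> elem (fun x => dotv (f x) (g x)).
Proof. by move=> ef eg; apply: elem_sum => i; exact: elemM. Qed.

Lemma measurable_sphere : measurable sphere.
Proof.
have m : measurable_fun [set: 'rV[R]_3] (fun x => dotv x x).
  apply: elem_measurable; apply: elem_dotv => i; exact: elem_coord.
rewrite (_ : sphere = setT `&` (fun x => dotv x x) @^-1` [set 1]).
  by apply: m => //; exact: measurable_set1.
by rewrite setTI.
Qed.

Lemma spherical_sphere p : sphere (spherical p).
Proof.
rewrite /Defs.sphere/= dotvE !mxE/=.
have := cos2Dsin2 p.1; have := cos2Dsin2 p.2.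
move: (cos p.1) (sin p.1) (cos p.2) (sin p.2) => C S c s e1 e2.
transitivity (S ^+ 2 * (c ^+ 2 + s ^+ 2) + C ^+ 2); first by ring.
by rewrite e1 mulr1 addrC.
Qed.

(** [sphere_area] is the image under [spherical] of the density [sin theta] on the rectangle of
    angles. Restricting to the sphere changes nothing, since [spherical] takes its values there. *)
Lemma integral_sphere (f : 'rV[R]_3 -> \bar R) :
  measurable_fun [set: 'rV[R]_3] f ->
  (\int[sphere_area]_(x in sphere) f x =
   \int[mu \x mu]_(p in angles) (f (spherical p) * (sin p.1)%:E))%E.
Proof.
move=> mf; rewrite integral_mkcond.
rewrite (@integral_image_density _ _ _ _ R (mu \x mu)%E sphere_area angles
  (@spherical R) (fun p => sin p.1)).
- apply: eq_integral => p _; rewrite patchE mem_set//; exact: spherical_sphere.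
- exact: measurable_angles.
- exact: measurable_spherical.
- apply: measurable_funTS; exact: (tame_fst (@continuous_sin R)).2.
- by move=> p [/= + _]; rewrite in_itv/= => /sin_ge0_pi.
- by [].
- apply: (measurable_restrictT _ measurable_sphere).1.
  exact: measurable_funTS.
Qed.

Lemma integral_sphere_elem f : elem f ->
  (\int[sphere_area]_(x in sphere) (f x)%:E =
   \int[mu \x mu]_(p in angles) (f (spherical p) * sin p.1)%:E)%E.
Proof.
move=> ef; rewrite integral_sphere//.
by apply/measurable_EFinP; exact: elem_measurable.
Qed.

Lemma elem_sin_tame f : elem f -> tame (fun p => f (@spherical R p) * sin p.1).
Proof.
by move=> ef; apply: tameM; [exact: tame_elem|exact: (tame_fst (@continuous_sin R))].
Qed.

Lemma elem_integrable f : elem f -> sphere_area.-integrable sphere (EFin \o f).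
Proof.
move=> ef; have mf := elem_measurable ef.
apply/integrableP; split; first by apply/measurable_EFinP/measurable_funTS.
rewrite integral_sphere; last first.
  by apply: measurableT_comp => //; exact/measurable_EFinP.
have /integrableP[_] := tame_integrable (elem_sin_tame ef).
apply: le_lt_trans; apply: ge0_le_integral => //=.
- exact: measurable_angles.
- move=> p [/= + _]; rewrite in_itv/= => /sin_ge0_pi s0.
  by rewrite mule_ge0.
- apply: measurable_funTS; apply: emeasurable_funM.
    apply: (@measurableT_comp _ _ _ _ _ _ abse _
      (fun p => (f (spherical p))%:E)) => //.
    by apply/measurable_EFinP; exact: (tame_elem ef).2.
  by apply/measurable_EFinP; exact: (tame_fst (@continuous_sin R)).2.
- apply: measurable_funTS; apply: (@measurableT_comp _ _ _ _ _ _ abse _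
    (fun p => (f (spherical p) * sin p.1)%:E)) => //.
  by apply/measurable_EFinP; exact: (elem_sin_tame ef).2.
- move=> p [/= + _]; rewrite in_itv/= => /sin_ge0_pi s0.
  by rewrite -EFinM normrM (ger0_norm s0).
Qed.

(** Through this congruence the equation [dotv x x = 1] becomes available when integrands are
    compared. *)
Lemma eq_sphere_int f g : (forall x, dotv x x = 1 -> f x = g x) ->
  sphere_int f = sphere_int g.
Proof. by move=> fg; apply: eq_Rintegral => x; rewrite inE => /fg. Qed.

Lemma sphere_intD f g : elem f -> elem g ->
  sphere_int (fun x => f x + g x) = sphere_int f + sphere_int g.
Proof.
move=> ef eg; apply: RintegralD; [exact: measurable_sphere|exact: elem_integrable..].
Qed.

Lemma sphere_intZ c f : elem f -> sphere_int (fun x => c * f x) = c * sphere_int f.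
Proof.
move=> ef; apply: RintegralZl; [exact: measurable_sphere|exact: elem_integrable].
Qed.

Lemma sphere_intN f : elem f -> sphere_int (fun x => - f x) = - sphere_int f.
Proof.
by move=> ef; under eq_fun do rewrite -mulN1r; rewrite sphere_intZ// mulN1r.
Qed.

Lemma sphere_intB f g : elem f -> elem g ->
  sphere_int (fun x => f x - g x) = sphere_int f - sphere_int g.
Proof. by move=> ef eg; rewrite sphere_intD ?sphere_intN//; exact: elemN. Qed.

Lemma sphere_int_sum (I : Type) (s : seq I) (F : I -> 'rV[R]_3 -> R) :
  (forall i, elem (F i)) ->
  sphere_int (fun x => \sum_(i <- s) F i x) = \sum_(i <- s) sphere_int (F i).
Proof.
move=> eF; elim: s => [|i s ih].
  rewrite big_nil -[RHS](mul0r (sphere_int (fun=> 0))) -sphere_intZ; last exact: elem_cst.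
  by apply: eq_sphere_int => x _; rewrite big_nil mul0r.
rewrite big_cons -ih -sphere_intD//; last exact: elem_sum.
by apply: eq_sphere_int => x _; rewrite big_cons.
Qed.

Lemma le_sphere_int f g : elem f -> elem g ->
  (forall x, dotv x x = 1 -> f x <= g x) -> sphere_int f <= sphere_int g.
Proof.
move=> ef eg fg; apply: le_Rintegral => //; [exact: measurable_sphere|exact: elem_integrable..].
Qed.

Lemma sphere_int_cst c : sphere_int (fun _ : 'rV[R]_3 => c) = c * (4 * pi).
Proof.
rewrite (_ : (fun _ => c) = fun _ : 'rV[R]_3 => c * 1); last by apply/funext => ?; rewrite mulr1.
rewrite sphere_intZ; last exact: elem_cst.
congr (c * _); rewrite /sphere_int /Rintegral integral_sphere_elem; last exact: elem_cst.
rewrite integral12_setX//; last first.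
  exact: (tame_integrable (elem_sin_tame (@elem_cst R 1))).
(* The azimuth contributes the factor [2 * pi]; the integral of the sine over [[0, pi]] is 2. *)
transitivity (fine (\int[mu]_(t in `[0%R, pi]) (1 * sin t * (2 * pi))%:E)%E).
  congr fine; apply: eq_integral => t _.
  transitivity (\int[mu]_(y in `[0%R, (2 * pi)%R]) (cst (1 * sin t)%:E) y)%E => //.
  by rewrite integral_cst//= lebesgue_measure_itv/= lte_fin mulr_gt0 ?pi_gt0// sube0.
have cg : continuous (fun t : R => 1 * sin t * (2 * pi)).
  move=> t; apply: cvgM; last exact: cvg_cst.
  by apply: cvgM; [exact: cvg_cst|exact: continuous_sin].
have dG (t : R) : is_derive t 1 (fun t => - cos t * (2 * pi)) (1 * sin t * (2 * pi)).
  apply: is_derive_eq (is_derive1M (is_derive1N (is_derive_cos t))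
    (is_derive1_cst (2 * pi) t)) _.
  by rewrite mulr0 add0r opprK mulrC mul1r.
rewrite (itv_integral_derive (pi_gt0 R) cg dG).
by rewrite /= cospi cos0; lra.
Qed.

End sphere_integral.

(** * The divergence theorem on the sphere *)

Section divergence.
Context (R : realType).
Local Notation mu := (@lebesgue_measure R).
Local Notation angles := (@angles R).
Implicit Types (f F : 'rV[R]_3 -> R) (x a : 'rV[R]_3).

(** The chain rule along a curve, by induction on the formula. It is applied to the meridians and
    parallels of the sphere. *)
Lemma is_derive_elem_curve F (c : R -> 'rV[R]_3) (t d0 d1 d2 : R) : elem F ->
  is_derive t 1 (fun s => c s ord0 j0) d0 ->
  is_derive t 1 (fun s => c s ord0 j1) d1 ->
  is_derive t 1 (fun s => c s ord0 j2) d2 ->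
  is_derive t 1 (fun s => F (c s)) (pderiv j0 F (c t) * d0 +
    pderiv j1 F (c t) * d1 + pderiv j2 F (c t) * d2).
Proof.
move=> eF h0 h1 h2; elim: eF => {F}.
- move=> k; rewrite !pderiv_cst !mul0r !addr0; exact: is_derive1_cst.
- move=> i; rewrite !pderiv_coord; case: i => [[|[|[|//]]] i3] /=.
  + by rewrite mul1r !mul0r !addr0 (_ : Ordinal i3 = j0)//; exact/val_inj.
  + by rewrite mul1r !mul0r addr0 add0r (_ : Ordinal i3 = j1)//; exact/val_inj.
  + by rewrite mul1r !mul0r !add0r (_ : Ordinal i3 = j2)//; exact/val_inj.
- move=> f g ef df eg dg; rewrite !pderivD//.
  by apply: is_derive_eq (is_derive1D df dg) _; ring.
- move=> f g ef df eg dg; rewrite !pderivM//.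
  by apply: is_derive_eq (is_derive1M df dg) _; ring.
- move=> f ef df; rewrite !pderiv_expR//.
  apply: is_derive_eq (is_derive1_comp (is_derive_expR (f (c t))) df) _.
  by rewrite /GRing.scale/=; ring.
- move=> f ef df f0; rewrite !pderiv_ln//.
  apply: is_derive_eq (is_derive1_comp (is_derive1_ln (f0 (c t))) df) _.
  by rewrite /GRing.scale/=; ring.
Qed.

Lemma elem_grad F i : elem F -> elem (fun x => sphere_grad F x ord0 i).
Proof.
move=> eF; rewrite /sphere_grad.
under eq_fun do rewrite !mxE.
apply: elemB; first exact: elem_pderiv.
apply: elemM; last exact: elem_coord.
apply: elem_dotv => j; last exact: elem_coord.
by under eq_fun do rewrite mxE; exact: elem_pderiv.
Qed.

(** With the unit tangent vectors [e_theta] and [e_phi], this is [sin theta * F * (a . e_theta)] and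
    [Aphi] is [F * (a . e_phi)]: the two flux components of the tangential part of [F a]. [dAtheta]
    and [dAphi] are their derivatives in [theta] and in [phi]. *)
Let Atheta F a (p : R * R) : R := sin p.1 * (F (spherical p) *
  (a ord0 j0 * cos p.2 * cos p.1 + a ord0 j1 * sin p.2 * cos p.1 + - (a ord0 j2) * sin p.1)).

Let Aphi F a (p : R * R) : R := F (spherical p) *
  (- (a ord0 j0) * sin p.2 + a ord0 j1 * cos p.2).

Let dAtheta F a (p : R * R) : R :=
  let g i := pderiv i F (spherical p) in
  let e := a ord0 j0 * cos p.2 * cos p.1 + a ord0 j1 * sin p.2 * cos p.1 + - (a ord0 j2) * sin p.1 in
  cos p.1 * (F (spherical p) * e) +
  sin p.1 * ((g j0 * (sin p.1 * 0 + cos p.2 * cos p.1) +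
              g j1 * (sin p.1 * 0 + sin p.2 * cos p.1) + g j2 * - sin p.1) * e +
    F (spherical p) * - (a ord0 j0 * cos p.2 * sin p.1 + a ord0 j1 * sin p.2 * sin p.1 +
       a ord0 j2 * cos p.1)).

Let dAphi F a (p : R * R) : R :=
  let g i := pderiv i F (spherical p) in
  (g j0 * - (sin p.1 * sin p.2) + g j1 * (sin p.1 * cos p.2)) *
    (- (a ord0 j0) * sin p.2 + a ord0 j1 * cos p.2) +
  F (spherical p) * - (a ord0 j0 * cos p.2 + a ord0 j1 * sin p.2).

(** The tangential part of the constant field [a] has divergence [- 2 (x . a)], so that of [F a] has
    divergence [grad F . a - 2 F (x . a)]. The right-hand side is the same divergence in spherical
    coordinates, times [sin theta]. *)
Lemma divergence_identity F a p :
  (dotv (sphere_grad F (spherical p)) a -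
    2 * (F (spherical p) * dotv (spherical p) a)) * sin p.1 =
  dAtheta F a p + dAphi F a p.
Proof.
rewrite /dAtheta /dAphi /sphere_grad !dotvE !mxE/=.
move: (F _) (pderiv j0 F _) (pderiv j1 F _) (pderiv j2 F _) => f g0 g1 g2.
move: (a ord0 j0) (a ord0 j1) (a ord0 j2) => a0 a1 a2.
have := cos2Dsin2 p.1; have := cos2Dsin2 p.2.
move: (cos p.1) (sin p.1) (cos p.2) (sin p.2) => C S c s e1 e2.
apply/eqP; rewrite -subr_eq0; apply/eqP.
(* The two sides differ by multiples of [c^2 + s^2 - 1] and of [C^2 + S^2 - 1]. *)
transitivity (S * ((1 - (c ^+ 2 + s ^+ 2)) * (g0 * a0 + g1 * a1) +
    (1 - (C ^+ 2 + S ^+ 2)) * ((g0 * c + g1 * s) * (a0 * c + a1 * s) + g2 * a2))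
  - f * (C ^+ 2 + S ^+ 2 - 1) * (a0 * c + a1 * s)); first by ring.
by rewrite e1 e2 !subrr; ring.
Qed.

Let is_derive_Atheta F a (t y : R) : elem F ->
  is_derive t 1 (fun s => Atheta F a (s, y)) (dAtheta F a (t, y)).
Proof.
move=> eF; pose c s := spherical (s, y).
have h0 : is_derive t 1 (fun s => c s ord0 j0) (cos y * cos t).
  under eq_fun do rewrite mxE/=.
  by apply: is_derive_eq (is_derive1M (is_derive_sin t) (is_derive1_cst _ t)) _; ring.
have h1 : is_derive t 1 (fun s => c s ord0 j1) (sin y * cos t).
  under eq_fun do rewrite mxE/=.
  by apply: is_derive_eq (is_derive1M (is_derive_sin t) (is_derive1_cst _ t)) _; ring.
have h2 : is_derive t 1 (fun s => c s ord0 j2) (- sin t).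
  by under eq_fun do rewrite mxE/=; exact: is_derive_cos.
have dF := is_derive_elem_curve eF h0 h1 h2.
have dc k := is_derive1M (is_derive1_cst k t) (is_derive_cos t).
have ds k := is_derive1M (is_derive1_cst k t) (is_derive_sin t).
have de := is_derive1D (is_derive1D (dc (a ord0 j0 * cos y)) (dc (a ord0 j1 * sin y)))
  (ds (- a ord0 j2)).
apply: is_derive_eq (is_derive1M (is_derive_sin t) (is_derive1M dF de)) _.
by rewrite /dAtheta /c /=; ring.
Qed.

Let is_derive_Aphi F a (x t : R) : elem F ->
  is_derive t 1 (fun s => Aphi F a (x, s)) (dAphi F a (x, t)).
Proof.
move=> eF; pose c s := spherical (x, s).
have h0 : is_derive t 1 (fun s => c s ord0 j0) (- (sin x * sin t)).
  under eq_fun do rewrite mxE/=.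
  by apply: is_derive_eq (is_derive1M (is_derive1_cst _ t) (is_derive_cos t)) _; ring.
have h1 : is_derive t 1 (fun s => c s ord0 j1) (sin x * cos t).
  under eq_fun do rewrite mxE/=.
  by apply: is_derive_eq (is_derive1M (is_derive1_cst _ t) (is_derive_sin t)) _; ring.
have h2 : is_derive t 1 (fun s => c s ord0 j2) 0.
  by under eq_fun do rewrite mxE/=; exact: is_derive1_cst.
have dF := is_derive_elem_curve eF h0 h1 h2.
have dc k := is_derive1M (is_derive1_cst k t) (is_derive_cos t).
have ds k := is_derive1M (is_derive1_cst k t) (is_derive_sin t).
apply: is_derive_eq (is_derive1M dF
  (is_derive1D (ds (- a ord0 j0)) (dc (a ord0 j1)))) _.
by rewrite /dAphi /c /=; ring.
Qed.

Ltac tame_tac eF :=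
  repeat first [ exact: tame_cst
    | exact: (tame_fst (@continuous_sin R)) | exact: (tame_fst (@continuous_cos R))
    | exact: (tame_snd (@continuous_sin R)) | exact: (tame_snd (@continuous_cos R))
    | exact: (tame_elem eF) | exact: (tame_elem (elem_pderiv _ eF))
    | apply: tameN | apply: tameD | apply: tameM ].

Let tame_dAtheta F a : elem F -> tame (dAtheta F a).
Proof. by move=> eF; rewrite /dAtheta /=; tame_tac eF. Qed.

Let tame_dAphi F a : elem F -> tame (dAphi F a).
Proof. by move=> eF; rewrite /dAphi /=; tame_tac eF. Qed.

Lemma elem_sphere_divergence F a : elem F ->
  elem (fun x => dotv (sphere_grad F x) a - 2 * (F x * dotv x a)).
Proof.
move=> eF; apply: elemB.
  by apply: elem_dotv => i; [exact: elem_grad|exact: elem_cst].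
apply: elemM; first exact: elem_cst.
apply: elemM => //; apply: elem_dotv => i; [exact: elem_coord|exact: elem_cst].
Qed.

(* In spherical coordinates the integrand, times the area density [sin theta],
   is the sum of a [theta]-derivative and of a [phi]-derivative. *)
Lemma sphere_divergence F a : elem F ->
  sphere_int (fun x => dotv (sphere_grad F x) a - 2 * (F x * dotv x a)) = 0.
Proof.
move=> eF; rewrite /sphere_int /Rintegral integral_sphere_elem; last first.
  exact: elem_sphere_divergence.
under eq_integral do rewrite divergence_identity.
rewrite (tame_integralD (tame_dAtheta a eF) (tame_dAphi a eF)).
(* The boundary terms cancel: [sin theta] vanishes at both poles, and everything is
   [2 * pi]-periodic in the azimuth. *)
have A0 (y : R) : Atheta F a (0, y) = Atheta F a (pi, y).
  by rewrite /Atheta/= sin0 sinpi !mul0r.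
have B0 (x : R) : Aphi F a (x, 0) = Aphi F a (x, 2 * pi).
  rewrite /Aphi/= mulr_natl.
  have -> : spherical (x, pi *+ 2) = spherical (x, 0).
    by apply/rowP => i; rewrite !mxE/= sin2pi cos2pi sin0 cos0.
  by rewrite sin2pi cos2pi sin0 cos0.
rewrite (tame_integral_dtheta (tame_dAtheta a eF)
  (fun x y : R => is_derive_Atheta a x y eF) A0).
rewrite (tame_integral_dphi (tame_dAphi a eF)
  (fun x y : R => is_derive_Aphi a x y eF) B0).
by rewrite adde0.
Qed.

End divergence.

(** * Invariance of the integral under a reflection and under rotations about the third axis *)

Section symmetry.
Context (R : realType).
Local Notation mu := (@lebesgue_measure R).
Local Notation angles := (@angles R).

Lemma integral_itv_shift (g : R -> R) (a b c : R) : a <= b -> continuous g ->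
  (\int[mu]_(x in `[a, b]) (g (x + c))%:E =
   \int[mu]_(x in `[(a + c)%R, (b + c)%R]) (g x)%:E)%E.
Proof.
move=> ab cg; pose F (x : R) := x + c.
have dF (x : R) : is_derive x 1 F 1.
  by apply: is_derive_eq (is_derive1D (is_derive_id x 1) (is_derive1_cst c x)) _; rewrite addr0.
have F'1 : derive1 F = cst 1 by apply/funext => x; rewrite derive1E derive_val.
have cF : continuous F.
  by move=> x; apply: cvgD; [exact: cvg_id|exact: cvg_cst].
rewrite (@integration_by_substitution_increasing R F g a b) ?F'1//.
- by apply: eq_integral => x _; rewrite !fctE/= mulr1.
- by move=> x y _ _ xy; rewrite /F ltrD2r.
- by move=> x _; exact: cvg_cst.
- exact: is_cvg_cst.
- exact: is_cvg_cst.
- split.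
  + by move=> x _; have [] := dF x.
  + by apply: cvg_at_right_filter; exact: cF.
  + by apply: cvg_at_left_filter; exact: cF.
- exact: continuous_subspaceT.
Qed.

Lemma continuous_integrable_itv (g : R -> R) (a b : R) : continuous g ->
  mu.-integrable `[a, b] (EFin \o g).
Proof.
move=> cg; apply: continuous_compact_integrable; first exact: segment_compact.
exact: continuous_subspaceT.
Qed.

Lemma integral_itv_split (g : R -> R) (a b c : R) : a <= b <= c -> continuous g ->
  (\int[mu]_(x in `[a, c]) (g x)%:E =
   \int[mu]_(x in `[a, b]) (g x)%:E + \int[mu]_(x in `[b, c]) (g x)%:E)%E.
Proof.
move=> /andP[ab bc] cg.
have fin (u v : R) : (\int[mu]_(x in `[u, v]) (g x)%:E)%E \is a fin_num.
  by apply: integrable_fin_num => //; exact: continuous_integrable_itv.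
rewrite -(fineK (fin a c)) -(fineK (fin a b)) -(fineK (fin b c)) -EFinD.
congr EFin; apply/eqP; rewrite addrC -subr_eq; apply/eqP.
transitivity (\int[mu]_(x in `]b, c]) g x).
  exact: (Rintegral_itvB (continuous_integrable_itv a c cg)).
apply: Rintegral_itv_obnd_cbnd.
apply: integrableS (continuous_integrable_itv b c cg) => //.
exact: subset_itv_oc_cc.
Qed.

Lemma integral_itv_reflect (g : R -> R) (b : R) : 0 <= b -> continuous g ->
  (\int[mu]_(x in `[0%R, b]) (g (b - x))%:E = \int[mu]_(x in `[0%R, b]) (g x)%:E)%E.
Proof.
move=> b0 cg; have cG : continuous (fun y : R => g (y + b)).
  move=> y; apply: (@continuous_comp _ _ _ (fun y => y + b) g); last exact: cg.
  by apply: cvgD; [exact: cvg_id|exact: cvg_cst].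
transitivity (\int[mu]_(x in `[0%R, b]) (((fun y => g (y + b)) \o -%R) x)%:E)%E.
  by apply: eq_integral => x _; rewrite /= addrC.
rewrite -integration_by_substitution_oppr//; last exact: continuous_subspaceT.
rewrite integral_itv_shift//; first by rewrite addNr oppr0 add0r.
by rewrite oppr0 oppr_le0.
Qed.

(** The translated interval [[c, P + c]] is cut at [P], and its part beyond [P] is moved back by one
    period onto [[0, c]]. *)
Lemma integral_itv_periodic (g : R -> R) (P c : R) : 0 <= c <= P -> continuous g ->
  (forall x, g (x + P) = g x) ->
  (\int[mu]_(x in `[0%R, P]) (g (x + c))%:E = \int[mu]_(x in `[0%R, P]) (g x)%:E)%E.
Proof.
move=> /andP[c0 cP] cg gP; have P0 := le_trans c0 cP.
rewrite integral_itv_shift// add0r (integral_itv_split (b := P))//; last first.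
  by rewrite cP lerDl.
rewrite [RHS](integral_itv_split (b := c)) ?c0// addeC; congr (_ + _)%E.
have := integral_itv_shift P c0 cg; rewrite add0r [c + P]addrC => <-.
by apply: eq_integral => x _; rewrite gP.
Qed.

Lemma tame_integral_reflect h : tame h ->
  (\int[mu \x mu]_(p in angles) (h (pi - p.1, p.2))%:E =
   \int[mu \x mu]_(p in angles) (h p)%:E)%E.
Proof.
move=> th; have [ch mh] := th.
have th' : tame (fun p => h (pi - p.1, p.2)).
  have t1 : tame (fun p : R * R => pi - p.1).
    apply: (tame_fst (g := fun x => pi - x)) => x.
    by apply: cvgB; [exact: cvg_cst|exact: cvg_id].
  have t2 : tame (fun p : R * R => p.2).
    by apply: (tame_snd (g := id)) => x; exact: cvg_id.
  split.
    move=> p; apply: (@continuous_comp _ _ _ (fun p => (pi - p.1, p.2)) h); last exact: ch.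
    by apply: (@cvg_pair _ _ _ _ (nbhs (pi - p.1)) (nbhs p.2)); [exact: t1.1|exact: t2.1].
  have mp : measurable_fun [set: R * R] (fun p : R * R => (pi - p.1, p.2)).
    by apply: measurable_fun_pair; [exact: t1.2|exact: t2.2].
  exact: (measurableT_comp mh mp).
rewrite !integral21_setX//; [|exact: tame_integrable..].
apply: eq_integral => y _.
exact: (integral_itv_reflect (pi_ge0 R) (@tame_section1 R h y th)).
Qed.

Lemma tame_integral_rotate h c : 0 <= c <= 2 * pi -> tame h ->
  (forall x y, h (x, y + 2 * pi) = h (x, y)) ->
  (\int[mu \x mu]_(p in angles) (h (p.1, p.2 + c))%:E =
   \int[mu \x mu]_(p in angles) (h p)%:E)%E.
Proof.
move=> c02 th hper; have [ch mh] := th.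
have th' : tame (fun p => h (p.1, p.2 + c)).
  have t1 : tame (fun p : R * R => p.1).
    by apply: (tame_fst (g := id)) => x; exact: cvg_id.
  have t2 : tame (fun p : R * R => p.2 + c).
    apply: (tame_snd (g := fun x => x + c)) => x.
    by apply: cvgD; [exact: cvg_id|exact: cvg_cst].
  split.
    move=> p; apply: (@continuous_comp _ _ _ (fun p => (p.1, p.2 + c)) h); last exact: ch.
    by apply: (@cvg_pair _ _ _ _ (nbhs p.1) (nbhs (p.2 + c))); [exact: t1.1|exact: t2.1].
  have mp : measurable_fun [set: R * R] (fun p : R * R => (p.1, p.2 + c)).
    by apply: measurable_fun_pair; [exact: t1.2|exact: t2.2].
  exact: (measurableT_comp mh mp).
rewrite !integral12_setX//; [|exact: tame_integrable..].
apply: eq_integral => x _.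
exact: (integral_itv_periodic c02 (@tame_section2 R h x th) (hper x)).
Qed.

Lemma elem_comp f (T : 'rV[R]_3 -> 'rV[R]_3) : elem f ->
  (forall i, elem (fun x => T x ord0 i)) -> elem (fun x => f (T x)).
Proof.
move=> ef eT; elim: ef => {f}.
- by move=> c; exact: elem_cst.
- by move=> i; exact: eT.
- by move=> f g _ ef _ eg; exact: elemD.
- by move=> f g _ ef _ eg; exact: elemM.
- by move=> f _ ef; exact: elem_expR.
- by move=> f _ ef f0; apply: elem_ln.
Qed.

Definition reflect3 (x : 'rV[R]_3) : 'rV[R]_3 :=
  \row_(i < 3) [:: x ord0 j0; x ord0 j1; - x ord0 j2]`_i.

Definition rotate3 (c : R) (x : 'rV[R]_3) : 'rV[R]_3 :=
  \row_(i < 3) [:: cos c * x ord0 j0 - sin c * x ord0 j1;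
                   sin c * x ord0 j0 + cos c * x ord0 j1; x ord0 j2]`_i.

(** In spherical coordinates the reflection is [theta -> pi - theta], which preserves
    [sin theta]. *)
Lemma sphere_int_reflect f : elem f ->
  sphere_int (fun x => f (reflect3 x)) = sphere_int f.
Proof.
move=> ef; rewrite /sphere_int /Rintegral !integral_sphere_elem//; last first.
  apply: elem_comp => // -[[|[|[|//]]] i3]; under eq_fun do rewrite mxE/=.
  - exact: elem_coord.
  - exact: elem_coord.
  - by apply: elemN; exact: elem_coord.
congr fine; rewrite -(tame_integral_reflect (elem_sin_tame ef)).
apply: eq_integral => p _.
have s1 : sin (pi - p.1) = sin p.1 by rewrite sinB sinpi cospi; ring.
have c1 : cos (pi - p.1) = - cos p.1 by rewrite cosB sinpi cospi; ring.
congr (EFin (f _ * _)); last by rewrite /= s1.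
by apply/rowP => -[[|[|[|//]]] i3]; rewrite !mxE/= ?s1 ?c1.
Qed.

(** In spherical coordinates the rotation is [phi -> phi + c], and the integrand is periodic in
    [phi]. *)
Lemma sphere_int_rotate f c : 0 <= c <= 2 * pi -> elem f ->
  sphere_int (fun x => f (rotate3 c x)) = sphere_int f.
Proof.
move=> c02 ef; rewrite /sphere_int /Rintegral !integral_sphere_elem//; last first.
  apply: elem_comp => // -[[|[|[|//]]] i3]; under eq_fun do rewrite mxE/=.
  - by apply: elemB; apply: elemM; (exact: elem_cst || exact: elem_coord).
  - by apply: elemD; apply: elemM; (exact: elem_cst || exact: elem_coord).
  - exact: elem_coord.
congr fine; rewrite -(tame_integral_rotate c02 (elem_sin_tame ef)).
  apply: eq_integral => p _; congr (EFin (f _ * _)).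
  by apply/rowP => -[[|[|[|//]]] i3]; rewrite !mxE/= ?sinD ?cosD; ring.
move=> x y /=; congr (f _ * _); apply/rowP => i.
by rewrite !mxE mulr_natl/= sinD2pi cosD2pi.
Qed.

End symmetry.

(** * Calculus of the spherical gradient *)

Section sphere_gradient.
Context (R : realType).
Implicit Types (f g h : 'rV[R]_3 -> R) (x y z : 'rV[R]_3).

Lemma dotvC x y : dotv x y = dotv y x.
Proof. by apply: eq_bigr => i _; rewrite mulrC. Qed.

Lemma dotvDl x y z : dotv (x + y) z = dotv x z + dotv y z.
Proof. by rewrite /dotv -big_split; apply: eq_bigr => i _; rewrite mxE mulrDl. Qed.

Lemma dotvZl c x y : dotv (c *: x) y = c * dotv x y.
Proof. by rewrite /dotv mulr_sumr; apply: eq_bigr => i _; rewrite mxE mulrA. Qed.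

Lemma dotvNl x y : dotv (- x) y = - dotv x y.
Proof. by rewrite -scaleN1r dotvZl mulN1r. Qed.

Lemma dotv_suml (I : Type) (s : seq I) (F : I -> 'rV[R]_3) y :
  dotv (\sum_(i <- s) F i) y = \sum_(i <- s) dotv (F i) y.
Proof.
elim: s => [|i s ih]; first by rewrite !big_nil -[0](scale0r 0) dotvZl mul0r.
by rewrite !big_cons dotvDl ih.
Qed.

(** At a fixed [x], [sphere_grad] is linear in the Euclidean gradient. As [c] and [d] may depend on
    [x], the rules for products, inverses and logarithms are all instances. *)
Lemma sphere_grad_lincomb f g h x (c d : R) :
  (forall i, pderiv i h x = c * pderiv i f x + d * pderiv i g x) ->
  sphere_grad h x = c *: sphere_grad f x + d *: sphere_grad g x.
Proof.
move=> E; apply/rowP => i.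
by rewrite /sphere_grad !dotvE !mxE !E; ring.
Qed.

Lemma sphere_grad_scale f h x (c : R) :
  (forall i, pderiv i h x = c * pderiv i f x) ->
  sphere_grad h x = c *: sphere_grad f x.
Proof.
move=> E; rewrite (@sphere_grad_lincomb f f h x c 0) ?scale0r ?addr0// => i.
by rewrite E mul0r addr0.
Qed.

Lemma sphere_gradM f g x : elem f -> elem g ->
  sphere_grad (fun x => f x * g x) x =
  f x *: sphere_grad g x + g x *: sphere_grad f x.
Proof. by move=> ef eg; apply: sphere_grad_lincomb => i; rewrite pderivM. Qed.

Lemma sphere_gradV f x : elem f -> (forall x, 0 < f x) ->
  sphere_grad (fun x => (f x)^-1) x = - (f x)^-2 *: sphere_grad f x.
Proof. by move=> ef f0; apply: sphere_grad_scale => i; rewrite pderivV. Qed.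

Lemma sphere_grad_ln f x : elem f -> (forall x, 0 < f x) ->
  sphere_grad (fun x => ln (f x)) x = (f x)^-1 *: sphere_grad f x.
Proof. by move=> ef f0; apply: sphere_grad_scale => i; rewrite pderiv_ln. Qed.

Lemma sphere_gradN f x : elem f ->
  sphere_grad (fun x => - f x) x = - sphere_grad f x.
Proof.
move=> ef; rewrite -scaleN1r; apply: sphere_grad_scale => i.
have -> : (fun x => - f x) = (fun x => (-1) * f x).
  by apply/funext => z; rewrite mulN1r.
by rewrite pderivM//; [rewrite pderiv_cst mulr0 addr0|exact: elem_cst].
Qed.

Lemma sphere_grad_sum (I : Type) (s : seq I) (F : I -> 'rV[R]_3 -> R) x :
  (forall i, elem (F i)) ->
  sphere_grad (fun x => \sum_(i <- s) F i x) x = \sum_(i <- s) sphere_grad (F i) x.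
Proof.
move=> eF; elim: s => [|i s ih].
  rewrite big_nil (@sphere_grad_scale (fun=> 0) _ x 0) ?scale0r// => i.
  by rewrite elem_pderiv_sum// big_nil mul0r.
rewrite big_cons -ih -[sphere_grad (F i) x]scale1r -[X in _ + X]scale1r.
by apply: sphere_grad_lincomb => j; rewrite !elem_pderiv_sum// big_cons !mul1r.
Qed.

Lemma dotv_sphere_grad f x : dotv x x = 1 -> dotv (sphere_grad f x) x = 0.
Proof.
by move=> x1; rewrite /sphere_grad dotvDl dotvNl dotvZl x1 mulr1 subrr.
Qed.

End sphere_gradient.

(** * A single bubble: gradient, Laplacian and integrals *)

Section bubble.
Context (R : realType) (e : R) (b : 'rV[R]_3).
Hypotheses (e0 : 0 < e) (b1 : dotv b b = 1).
Implicit Types (x v : 'rV[R]_3) (f : 'rV[R]_3 -> R).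

(* On the unit sphere this is [1 + e - dotv x b]; written in this way it is
   positive on the whole space. *)
Definition bubble x : R := e + 2^-1 * dotv (x - b) (x - b).

Lemma bubble_gt0 x : 0 < bubble x.
Proof.
rewrite ltr_pwDl// mulr_ge0//; apply: sumr_ge0 => i _.
by rewrite -expr2 sqr_ge0.
Qed.

Lemma elem_bubble : elem bubble.
Proof.
apply: elemD; first exact: elem_cst.
apply: elemM; first exact: elem_cst.
by apply: elem_dotv => i; under eq_fun do rewrite !mxE;
  apply: elemB; (exact: elem_coord || exact: elem_cst).
Qed.

Lemma bubble_sphere x : dotv x x = 1 -> bubble x = 1 + e - dotv x b.
Proof.
move: b1; rewrite /bubble !dotvE !mxE => h1 h2.
by move: h1 h2; do 6 move: (_ ord0 _) => ?; lra.
Qed.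

Lemma pderiv_bubble i x : pderiv i bubble x = x ord0 i - b ord0 i.
Proof.
have eB j : elem (fun x => x ord0 j - b ord0 j).
  by apply: elemB; (exact: elem_coord || exact: elem_cst).
have -> : bubble = fun x => e + 2^-1 * \sum_(j < 3) (x ord0 j - b ord0 j) * (x ord0 j - b ord0 j).
  by apply/funext => z; rewrite /bubble /dotv; under eq_bigr do rewrite !mxE.
rewrite pderivD; [|exact: elem_cst|]; last first.
  by apply: elemM; [exact: elem_cst|apply: elem_sum => j; exact: elemM].
rewrite pderiv_cst pderivM; [|exact: elem_cst|by apply: elem_sum => j; exact: elemM].
rewrite pderiv_cst elem_pderiv_sum; last by move=> j; exact: elemM.
have dB j : pderiv i (fun x => x ord0 j - b ord0 j) = fun=> (i == j)%:R.
  rewrite pderivD; [|exact: elem_coord|exact: elem_cst].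
  by rewrite pderiv_coord pderiv_cst; apply/funext => ?; rewrite addr0.
rewrite (bigD1 i)//= big1 => [|j ji]; rewrite pderivM// !dB.
  have -> : (i == i)%:R = 1 :> R by rewrite eqxx.
  rewrite mulr0 !addr0 add0r !mulr1; by field.
have -> : (i == j)%:R = 0 :> R by rewrite eq_sym (negbTE ji).
by rewrite mulr0 addr0.
Qed.

(** The Euclidean gradient is [x - b]; its projection is minus the tangential part of [b] at [x]. *)
Lemma sphere_grad_bubble x : dotv x x = 1 ->
  sphere_grad bubble x = dotv x b *: x - b.
Proof.
move=> x1; apply/rowP => i; rewrite /sphere_grad !mxE pderiv_bubble.
have -> : dotv (\row_(j < 3) pderiv j bubble x) x = 1 - dotv x b.
  rewrite -x1 !dotvE !mxE !pderiv_bubble; ring.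
ring.
Qed.

Lemma dotv_grad_bubble x : dotv x x = 1 ->
  dotv (sphere_grad bubble x) b = dotv x b ^+ 2 - 1.
Proof.
by move=> x1; rewrite sphere_grad_bubble// dotvDl dotvNl dotvZl b1 expr2.
Qed.

Lemma elem_bubbleV : elem (fun x => (bubble x)^-1).
Proof. exact: elemV elem_bubble bubble_gt0. Qed.

Lemma elem_bubbleV2 : elem (fun x => (bubble x)^-2).
Proof. by under eq_fun do rewrite -exprVn; exact: elemX elem_bubbleV. Qed.

Lemma elem_ln_bubble : elem (fun x => ln (bubble x)).
Proof. exact: elem_ln elem_bubble bubble_gt0. Qed.

(** This is [(1 + e)^2 - 1]. With [s = x . b] and [y = 1 + e - s] one has
    [(1 - s^2) - 2 s y = y^2 - kappa], which is how it enters the Laplacian. *)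
Let kappa := 2 * e + e ^+ 2.

(* The choice [F = f / bubble] in the divergence theorem: the Laplacian of
   [- ln bubble] is [1 - kappa / bubble ^ 2]. *)
Lemma sphere_int_bubble_parts f : elem f ->
  sphere_int (fun x => (bubble x)^-1 * dotv (sphere_grad f x) b) =
  sphere_int (fun x => f x * (kappa * (bubble x)^-2 - 1)).
Proof.
move=> ef; apply/eqP; rewrite -subr_eq0; apply/eqP.
have e1 : elem (fun x => (bubble x)^-1 * dotv (sphere_grad f x) b).
  apply: elemM; first exact: elem_bubbleV.
  by apply: elem_dotv => i; [exact: elem_grad|exact: elem_cst].
have e2 : elem (fun x => f x * (kappa * (bubble x)^-2 - 1)).
  apply: elemM => //; apply: elemB; last exact: elem_cst.
  by apply: elemM; [exact: elem_cst|exact: elem_bubbleV2].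
rewrite -sphere_intB// -[RHS](sphere_divergence b (elemM ef elem_bubbleV)).
apply: eq_sphere_int => x x1.
rewrite sphere_gradM//; last exact: elem_bubbleV.
rewrite sphere_gradV; [|exact: elem_bubble|exact: bubble_gt0].
have := dotv_grad_bubble x1; move: (sphere_grad f x) (sphere_grad bubble x) => H B hB.
rewrite dotvDl !dotvZl hB /kappa.
have := bubble_gt0 x; rewrite (bubble_sphere x1).
move: (f x) (dotv H b) (dotv x b) => F G s y0.
by field; rewrite gt_eqF.
Qed.

(** In the integration by parts with [f = 1] the left-hand side vanishes, so [kappa / bubble^2] has
    the same integral as 1. *)
Lemma sphere_int_bubbleV2 : sphere_int (fun x => (bubble x)^-2) = 4 * pi / kappa.
Proof.
have := sphere_int_bubble_parts (@elem_cst R 1).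
have k0 : kappa != 0 by rewrite /kappa gt_eqF// addr_gt0// ?mulr_gt0// exprn_gt0.
have ek : elem (fun x => kappa * (bubble x)^-2).
  by apply: elemM; [exact: elem_cst|exact: elem_bubbleV2].
rewrite (@eq_sphere_int _ _ (fun=> 0)); last first.
  move=> x _; rewrite (@sphere_grad_scale _ (fun=> 0) _ x 0) ?scale0r.
    by rewrite -[0](scale0r 0) dotvZl mul0r mulr0.
  by move=> i; rewrite pderiv_cst mul0r.
rewrite sphere_int_cst mul0r => /esym.
rewrite (@eq_sphere_int _ _ (fun x => kappa * (bubble x)^-2 - 1)); last first.
  by move=> x _; rewrite mul1r.
rewrite sphere_intB//; last exact: elem_cst.
rewrite sphere_intZ ?sphere_int_cst ?mul1r; last exact: elem_bubbleV2.
by move/eqP; rewrite subr_eq0 => /eqP <-; rewrite mulrAC divff// mul1r.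
Qed.

Lemma bubble_le x : dotv x x = 1 -> bubble x <= 2 + e.
Proof.
have : 0 <= dotv (x + b) (x + b) by apply: sumr_ge0 => i _; rewrite -expr2 sqr_ge0.
move: b1; rewrite /bubble !dotvE !mxE => h1 h2 h3.
by move: h1 h2 h3; do 6 move: (_ ord0 _) => ?; lra.
Qed.

Lemma ln_bubble_le x : e <= 1 -> dotv x x = 1 -> ln (bubble x) <= 2.
Proof.
move=> e1 x1; have y0 := bubble_gt0 x.
have : ln (1 + (bubble x - 1)) <= bubble x - 1 by apply: le_ln1Dx; lra.
by rewrite addrC subrK => /le_trans; apply; have := bubble_le x1; lra.
Qed.

(* The divergence theorem applied to [ln bubble]. *)
Lemma sphere_int_ln_bubble : e <= 1 -> - (2 * (4 * pi)) <= sphere_int (fun x => ln (bubble x)).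
Proof.
move=> e1.
have el : elem (fun x => (2 * (1 + e)) * ln (bubble x)).
  by apply: elemM; [exact: elem_cst|exact: elem_ln_bubble].
have ed := elem_sphere_divergence b elem_ln_bubble.
(* With [y] the bubble and [s = x . b], the factor [2 (1 + e)] turns the logarithmic terms into
   [2 y ln y >= 2 (y - 1) >= - 2]. The remaining term [(s^2 - 1) / y] is at least [- 2], because
   [s^2 - 1 + 2 y = (s - 1)^2 + 2 e]. *)
have : sphere_int (fun x : 'rV[R]_3 => - 4) <= sphere_int (fun x => (2 * (1 + e)) * ln (bubble x) +
    (dotv (sphere_grad (fun x => ln (bubble x)) x) b - 2 * (ln (bubble x) * dotv x b)) ).
  apply: le_sphere_int; [exact: elem_cst|exact: elemD|move=> x x1].
  rewrite sphere_grad_ln; [|exact: elem_bubble|exact: bubble_gt0].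
  have := dotv_grad_bubble x1; move: (sphere_grad bubble x) => B hB.
  rewrite dotvZl hB; have y0 := bubble_gt0 x; have ys := bubble_sphere x1.
  have lny : ln (1 + ((bubble x)^-1 - 1)) <= (bubble x)^-1 - 1.
    by apply: le_ln1Dx; have : 0 < (bubble x)^-1 by [rewrite invr_gt0]; lra.
  rewrite addrC subrK lnV ?posrE// in lny.
  move: (ln _) (dotv x b) lny ys => l s lny ys.
  have yl : bubble x - 1 <= bubble x * l.
    have := ler_wpM2l (ltW y0) lny.
    by rewrite mulrBr divff ?gt_eqF// mulr1 mulrN; lra.
  have w2 : - 2 <= (bubble x)^-1 * (s ^+ 2 - 1).
    have -> : (bubble x)^-1 * (s ^+ 2 - 1) =
        (bubble x)^-1 * (2 * bubble x + s ^+ 2 - 1) - 2 by field; rewrite gt_eqF.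
    rewrite lerDr; apply: mulr_ge0; first by rewrite invr_ge0 ltW.
    rewrite ys.
    have -> : 2 * (1 + e - s) + s ^+ 2 - 1 = (s - 1) ^+ 2 + 2 * e by ring.
    by rewrite addr_ge0 ?sqr_ge0// mulr_ge0// ltW.
  move: (_^-1 * _) w2 => w w2; rewrite {}ys in yl y0; lra.
rewrite sphere_int_cst sphere_intD// sphere_divergence ?addr0; last exact: elem_ln_bubble.
rewrite sphere_intZ; last exact: elem_ln_bubble.
have := pi_gt0 R; move: (sphere_int _) => I p0 h.
(* For negative [I], discarding the term [2 e I <= 0] only weakens the lower bound on [2 I]. *)
have [I0|I0] := leP 0 I; first by lra.
have : e * I <= 0 by rewrite mulr_ge0_le0// ltW.
by lra.
Qed.

End bubble.

(** * Elementary functions as elements of the Sobolev space *)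

Section sobolev.
Context (R : realType).

Lemma elem_sphere_L2 (f : 'rV[R]_3 -> R) : elem f -> sphere_L2 f.
Proof.
move=> ef; split; first by apply: measurable_funTS; exact: elem_measurable.
exact: (elem_integrable (elemX 2 ef)).
Qed.

(** The function is itself smooth, so the constant sequence approximates it. *)
Lemma elem_sobolev_grad (f : 'rV[R]_3 -> R) : elem f ->
  is_sobolev_grad f (sphere_grad f).
Proof.
move=> ef; split; first exact: elem_sphere_L2.
  by move=> i; apply: elem_sphere_L2; exact: elem_grad.
exists (fun=> f); split; first by move=> _; exact: elem_smooth.
- under eq_fun do under eq_integral do rewrite subrr expr0n/=.
  by under eq_fun do rewrite integral0; exact: cvg_cst.
- under eq_fun do under eq_integral do rewrite subrr -[0](scale0r (0 : 'rV[R]_3)) dotvZl mul0r.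
  by under eq_fun do rewrite integral0; exact: cvg_cst.
Qed.

Definition H1_elem (f : 'rV[R]_3 -> R) (ef : elem f) : H1_sphere R :=
  MkH1Sphere (elem_sobolev_grad ef).

End sobolev.

(** * First and second moments of a symmetric weight *)

Section symmetric_weight.
Context (R : realType) (w : 'rV[R]_3 -> R) (t : R).
Hypotheses (ew : elem w) (w_reflect : forall x, w (reflect3 x) = w x).
Hypotheses (w_rotate : forall x, w (rotate3 t x) = w x).
Hypotheses (t02 : 0 <= t <= 2 * pi) (cost : cos t = - 2^-1).

Let sint : sin t ^+ 2 = 3 / 4.
Proof. by have := cos2Dsin2 t; rewrite cost; lra. Qed.

Let I1 i := sphere_int (fun x => x ord0 i * w x).
Let I2 i j := sphere_int (fun x => x ord0 i * x ord0 j * w x).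

Let e1 i : elem (fun x => x ord0 i * w x).
Proof. by apply: elemM => //; exact: elem_coord. Qed.

Let e2 i j : elem (fun x => x ord0 i * x ord0 j * w x).
Proof. by apply: elemM => //; apply: elemM; exact: elem_coord. Qed.

Let ec1 c i : elem (fun x => c * (x ord0 i * w x)).
Proof. by apply: elemM; [exact: elem_cst|exact: e1]. Qed.

Let ec2 c i j : elem (fun x => c * (x ord0 i * x ord0 j * w x)).
Proof. by apply: elemM; [exact: elem_cst|exact: e2]. Qed.

(** The third moment changes sign under the reflection. The first two form a plane vector fixed by a
    rotation that is not the identity. *)
Lemma sym_moment1 i : I1 i = 0.
Proof.
have h2 : I1 j2 = - I1 j2.
  rewrite {1}/I1 -(sphere_int_reflect (e1 j2)) -sphere_intN//.
  by apply: eq_sphere_int => x _; rewrite w_reflect !mxE/= mulNr.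
have h0 : I1 j0 = cos t * I1 j0 - sin t * I1 j1.
  rewrite {1}/I1 -(sphere_int_rotate t02 (e1 j0)) -!sphere_intZ// -sphere_intB//.
  by apply: eq_sphere_int => x _; rewrite w_rotate !mxE/=; ring.
have h1 : I1 j1 = sin t * I1 j0 + cos t * I1 j1.
  rewrite {1}/I1 -(sphere_int_rotate t02 (e1 j1)) -!sphere_intZ// -sphere_intD//.
  by apply: eq_sphere_int => x _; rewrite w_rotate !mxE/=; ring.
have z0 : I1 j0 = 0.
  (* Eliminating [I1 j1] shows that the nonzero number [(1 - cos t)^2 + (sin t)^2] annihilates
     [I1 j0]. *)
  have : (1 - cos t) * I1 j0 * (1 - cos t) = - (sin t ^+ 2) * I1 j0.
    have -> : (1 - cos t) * I1 j0 = - sin t * I1 j1 by lra.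
    have q1 : (1 - cos t) * I1 j1 = sin t * I1 j0 by lra.
    by rewrite mulrAC -mulrA q1; ring.
  by rewrite sint cost; lra.
have z1 : I1 j1 = 0 by move: h1; rewrite z0 cost; lra.
have z2 : I1 j2 = 0 by lra.
by case: i => [[|[|[|//]]] i3];
  [rewrite -z0|rewrite -z1|rewrite -z2]; congr I1; exact/val_inj.
Qed.

(** The reflection kills the mixed moments with the third coordinate. In the horizontal plane the
    traceless part of the moment matrix is turned by the angle [2 t], so invariance forces it to
    vanish. *)
Lemma sym_moment2 : [/\ I2 j0 j1 = 0, I2 j0 j2 = 0, I2 j1 j2 = 0 &
  I2 j0 j0 = I2 j1 j1].
Proof.
have h i : i != j2 -> I2 i j2 = - I2 i j2.
  move=> i2; rewrite {1}/I2 -(sphere_int_reflect (e2 i j2)) -sphere_intN//.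
  apply: eq_sphere_int => x _; rewrite w_reflect !mxE/=.
  by move: i2; case: i => [[|[|[|//]]] i3]//= _; rewrite mulrN mulNr; congr (- (x _ _ * _ * _));
    exact/val_inj.
have h00 : I2 j0 j0 = cos t ^+ 2 * I2 j0 j0 - 2 * cos t * sin t * I2 j0 j1
    + sin t ^+ 2 * I2 j1 j1.
  rewrite {1}/I2 -(sphere_int_rotate t02 (e2 j0 j0)) -!sphere_intZ//.
  rewrite -sphere_intB// -sphere_intD//; last exact: elemB.
  by apply: eq_sphere_int => x _; rewrite w_rotate !mxE/=; ring.
have h01 : I2 j0 j1 = cos t * sin t * I2 j0 j0 + (cos t ^+ 2 - sin t ^+ 2) * I2 j0 j1
    - cos t * sin t * I2 j1 j1.
  rewrite {1}/I2 -(sphere_int_rotate t02 (e2 j0 j1)) -!sphere_intZ//.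
  rewrite -sphere_intD// -sphere_intB//; last exact: elemD.
  by apply: eq_sphere_int => x _; rewrite w_rotate !mxE/=; ring.
have D0 : I2 j0 j0 - I2 j1 j1 = 0.
  have p1 : 3 / 4 * (I2 j0 j0 - I2 j1 j1) = sin t * I2 j0 j1.
    by move: h00; rewrite sint cost; lra.
  (* With [D = I2 j0 j0 - I2 j1 j1], the two relations read
     [3 D / 4 = sin t * I2 j0 j1 = - D / 4]. *)
  have p2 : sin t * I2 j0 j1 = - (1 / 3) * (sin t ^+ 2 * (I2 j0 j0 - I2 j1 j1)).
    have : I2 j0 j1 = - (1 / 3) * (sin t * (I2 j0 j0 - I2 j1 j1)).
      by move: h01; rewrite sint cost; lra.
    by move=> {1}->; ring.
  by move: p1; rewrite p2 sint; lra.
have z01 : I2 j0 j1 = 0.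
  by move: h01; rewrite sint cost; nra.
have z02 := h j0 isT; have z12 := h j1 isT.
by split => //; lra.
Qed.

End symmetric_weight.

(** * Center of mass and Lambda of a symmetric function *)

Section lambda.
Context (R : realType) (u : 'rV[R]_3 -> R) (eu : elem u) (t : R).
Hypotheses (u_reflect : forall x, u (reflect3 x) = u x).
Hypotheses (u_rotate : forall x, u (rotate3 t x) = u x).
Hypotheses (t02 : 0 <= t <= 2 * pi) (cost : cos t = - 2^-1).

Let w x := expR (2 * u x).
Let ew : elem w.
Proof. by apply: elem_expR; apply: elemM => //; exact: elem_cst. Qed.
Let w_reflect x : w (reflect3 x) = w x. Proof. by rewrite /w u_reflect. Qed.
Let w_rotate x : w (rotate3 t x) = w x. Proof. by rewrite /w u_rotate. Qed.

Lemma sym_M1 : M1 (H1_elem eu).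
Proof. by move=> i; exact: (sym_moment1 ew w_reflect w_rotate t02 cost). Qed.

Let Z := sphere_int w.
Let I2 i j := sphere_int (fun x => x ord0 i * x ord0 j * w x).

Let e2 i j : elem (fun x => x ord0 i * x ord0 j * w x).
Proof. by apply: elemM => //; apply: elemM; exact: elem_coord. Qed.

Let LambdaE i j : Lambda (H1_elem eu) i j = (I2 i j - 3^-1 * (i == j)%:R * Z) / Z.
Proof.
rewrite mxE; congr (_ / _); rewrite /Z -sphere_intZ// -sphere_intB//; last first.
  by apply: elemM => //; exact: elem_cst.
by apply: eq_sphere_int => x _; rewrite -/(w x); ring.
Qed.

Lemma sym_frobenius : 0 < Z -> frobenius (Lambda (H1_elem eu)) ^+ 2 =
  3 / 2 * (sphere_int (fun x => x ord0 j2 ^+ 2 * w x) / Z - 1 / 3) ^+ 2.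
Proof.
move=> Z0; rewrite /frobenius sqr_sqrtr; last first.
  by apply: sumr_ge0 => i _; apply: sumr_ge0 => j _; exact: sqr_ge0.
have [z01 z02 z12 d01] := sym_moment2 ew w_reflect w_rotate t02 cost.
have sym i j : I2 i j = I2 j i.
  by apply: eq_sphere_int => x _; rewrite [x _ _ * x _ _]mulrC.
(* On the sphere the squares of the coordinates add up to 1. Together with [d01] this expresses
   every diagonal entry by [I2 j2 j2] and [Z]. *)
have tr : I2 j0 j0 + I2 j1 j1 + I2 j2 j2 = Z.
  rewrite -!sphere_intD//; last exact: elemD.
  by apply: eq_sphere_int => x; rewrite dotvE => x1; rewrite -!mulrDl x1 mul1r.
have -> : sphere_int (fun x => x ord0 j2 ^+ 2 * w x) = I2 j2 j2.
  by apply: eq_sphere_int => x _; rewrite expr2.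
rewrite sum3E !sum3E !LambdaE /= (sym j1 j0) (sym j2 j0) (sym j2 j1).
have {}z01 : I2 j0 j1 = 0 := z01.
have {}z02 : I2 j0 j2 = 0 := z02.
have {}z12 : I2 j1 j2 = 0 := z12.
have {}d01 : I2 j0 j0 = I2 j1 j1 := d01.
rewrite z01 z02 z12 d01 in tr *.
have -> : I2 j1 j1 = (Z - I2 j2 j2) / 2 by lra.
by field; rewrite gt_eqF.
Qed.

End lambda.

(** * Sums of bubbles: mass, energy, functional and concentration *)

Section bubbles.
Context (R : realType) (N : nat) (a : 'I_N -> 'rV[R]_3) (e : R).
Hypotheses (e0 : 0 < e) (e1 : e <= 1) (a1 : forall i, dotv (a i) (a i) = 1).

(** This is [exp (- bubbles)]. The geometric conditions on the points are stated for it, because for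
    explicit points they become polynomial inequalities. *)
Definition bubbles_prod (x : 'rV[R]_3) : R := \prod_(i < N) bubble e (a i) x.

Definition bubbles (x : 'rV[R]_3) : R := - \sum_(i < N) ln (bubble e (a i) x).

Lemma elem_bubbles : elem bubbles.
Proof. by apply: elemN; apply: elem_sum => i; exact: elem_ln_bubble. Qed.

Lemma bubbles_prod_gt0 x : 0 < bubbles_prod x.
Proof. by apply: prodr_gt0 => i _; exact: bubble_gt0. Qed.

Lemma expR_bubbles x : expR (bubbles x) = (bubbles_prod x)^-1.
Proof.
rewrite expRN expR_sum; congr (_^-1); apply: eq_bigr => i _.
by rewrite lnK// posrE bubble_gt0.
Qed.

Lemma bubblesE x : bubbles x = - ln (bubbles_prod x).
Proof. by rewrite -[LHS]expRK expR_bubbles lnV// posrE bubbles_prod_gt0. Qed.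

Lemma expR_bubbles2 x : expR (2 * bubbles x) = (bubbles_prod x)^-2.
Proof. by rewrite expRM_natl expR_bubbles exprVn. Qed.

Lemma elem_expR_bubbles : elem (fun x => expR (2 * bubbles x)).
Proof.
by apply: elem_expR; apply: elemM; [exact: elem_cst|exact: elem_bubbles].
Qed.

Lemma bubbles_ge x : dotv x x = 1 -> - (2 * N%:R) <= bubbles x.
Proof.
move=> x1; rewrite lerN2 mulr_natr -[in leRHS](card_ord N) -sumr_const.
by apply: ler_sum => i _; exact: ln_bubble_le.
Qed.

Lemma bubbles_ge1 i x : dotv x x = 1 ->
  - ln (bubble e (a i) x) - 2 * N%:R <= bubbles x.
Proof.
move=> x1; rewrite -opprD lerN2 (bigD1 i)//= lerD2l.
apply: (@le_trans _ _ (\sum_(j < N | j != i) 2)).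
  by apply: ler_sum => j _; exact: ln_bubble_le.
rewrite mulr_natr -[in leRHS](card_ord N) -sumr_const.
by rewrite [leRHS](bigD1 i)//= lerDr.
Qed.

Let kappa := 2 * e + e ^+ 2.
Let kappa_gt0 : 0 < kappa.
Proof. by rewrite /kappa addr_gt0// ?mulr_gt0// exprn_gt0. Qed.

Let kappa_le : kappa <= 3 * e.
Proof. by have : e * e <= e; [rewrite ger_pMr|rewrite /kappa expr2; lra]. Qed.

(** All logarithms but one are bounded above by 2, so [e^(2u)] is at least [e^(- 4 N)] times the
    inverse square of a single bubble, whose integral is known. *)
Lemma sphere_int_expR_bubbles : (0 < N)%N ->
  expR (- (4 * N%:R)) * (4 * pi / kappa) <= sphere_int (fun x => expR (2 * bubbles x)).
Proof.
move=> N0; pose i := Ordinal N0.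
rewrite -(sphere_int_bubbleV2 e0 (a1 i)) -sphere_intZ; last exact: elem_bubbleV2.
apply: le_sphere_int; [|exact: elem_expR_bubbles|move=> x x1].
  by apply: elemM; [exact: elem_cst|exact: elem_bubbleV2].
have y0 := bubble_gt0 (a i) e0 x.
rewrite -[bubble e (a i) x]lnK ?posrE// -expRM_natl -expRN -expRD ler_expR.
by have := bubbles_ge1 i x1; rewrite mulr_natl mulr2n; lra.
Qed.

Lemma sphere_int_bubbles : sphere_int bubbles <= 2 * N%:R * (4 * pi).
Proof.
have el i : elem (fun x => ln (bubble e (a i) x)) by exact: elem_ln_bubble.
rewrite sphere_intN; last exact: elem_sum.
rewrite sphere_int_sum// -sumrN mulrAC mulr_natr -[in leRHS](card_ord N) -sumr_const.
apply: ler_sum => i _; rewrite lerNl.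
exact: sphere_int_ln_bubble.
Qed.

(** It bounds [u] by [- ln e], the bound that a single bubble satisfies; it is checked separately
    for each configuration of points. *)
Hypothesis W_ge : forall x, dotv x x = 1 -> e <= bubbles_prod x.

Lemma bubbles_le x : dotv x x = 1 -> bubbles x <= - ln e.
Proof.
by move=> x1; rewrite bubblesE lerN2 ler_ln ?posrE ?bubbles_prod_gt0// W_ge.
Qed.

Lemma sphere_grad_bubbles x : sphere_grad bubbles x =
  - \sum_(i < N) (bubble e (a i) x)^-1 *: sphere_grad (bubble e (a i)) x.
Proof.
have el i : elem (fun x => ln (bubble e (a i) x)) by exact: elem_ln_bubble.
rewrite sphere_gradN; last exact: elem_sum.
rewrite sphere_grad_sum//; congr (- _); apply: eq_bigr => i _.
rewrite sphere_grad_ln//; first exact: elem_bubble.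
by move=> z; exact: bubble_gt0.
Qed.

(** Since [grad u] is tangent and [grad y_i] is minus the tangential part of [a_i], one has
    [|grad u|^2 = sum_i (grad u . a_i) / y_i]. Integration by parts against each bubble then leaves
    only values of [u], not of its gradient. *)
Lemma energy_bubbles :
  sphere_int (fun x => dotv (sphere_grad bubbles x) (sphere_grad bubbles x)) <=
  N%:R * (2 * N%:R - ln e) * (4 * pi).
Proof.
have eu := elem_bubbles; have eg i := elem_grad i eu.
have ep i : elem (fun x => (bubble e (a i) x)^-1 * dotv (sphere_grad bubbles x) (a i)).
  apply: elemM; first exact: elem_bubbleV.
  by apply: elem_dotv => j //; exact: elem_cst.
rewrite (@eq_sphere_int _ _ (fun x => \sum_(i < N) (bubble e (a i) x)^-1 *
    dotv (sphere_grad bubbles x) (a i))); last first.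
  move=> x x1; have gx := dotv_sphere_grad bubbles x1.
  rewrite {1}sphere_grad_bubbles; move: (sphere_grad bubbles x) gx => G gx.
  rewrite dotvNl dotv_suml -sumrN; apply: eq_bigr => i _.
  rewrite sphere_grad_bubble//.
  by rewrite dotvZl dotvDl dotvNl dotvZl [dotv x G]dotvC gx [dotv (a i) G]dotvC; ring.
rewrite sphere_int_sum// -mulrA mulr_natl -[X in _ <= _ *+ X](card_ord N) -sumr_const.
apply: ler_sum => i _; rewrite sphere_int_bubble_parts// -/kappa.
have ev : elem (fun x => (bubble e (a i) x)^-2) by exact: elem_bubbleV2.
(* The integrand [u (kappa / y_i^2 - 1)] is bounded by using [u <= - ln e] in the first term and
   [- u <= 2 N] in the second; [kappa / y_i^2] integrates to [4 pi]. *)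
have -> : (2 * N%:R - ln e) * (4 * pi) =
    sphere_int (fun x => - ln e * kappa * (bubble e (a i) x)^-2 + 2 * N%:R).
  rewrite sphere_intD; [|by apply: elemM => //; exact: elem_cst|exact: elem_cst].
  rewrite sphere_intZ// sphere_int_bubbleV2// sphere_int_cst -/kappa.
  by field; rewrite gt_eqF.
apply: le_sphere_int.
- apply: elemM => //; apply: elemB; last exact: elem_cst.
  by apply: elemM => //; exact: elem_cst.
- by apply: elemD; [apply: elemM => //; exact: elem_cst|exact: elem_cst].
move=> x x1; have ul := bubbles_le x1; have ug := bubbles_ge x1.
have v0 : 0 <= kappa * (bubble e (a i) x)^-2.
  by apply: mulr_ge0; [exact: ltW|rewrite -exprVn sqr_ge0].
by rewrite -mulrA; move: (kappa * _) v0 => v v0; nra.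
Qed.

(** In the constant, [4 N + ln 3] comes from the logarithm of the mass, with [kappa <= 3 e];
    [2 alpha N^2] from the energy; and another [4 N] from twice the mean of [u]. *)
Lemma J_bubbles (alpha : R) : (0 < N)%N -> 0 < alpha ->
  (1 - alpha * N%:R) * (- ln e) - (8 * N%:R + ln 3 + 2 * alpha * N%:R ^+ 2) <=
  J alpha (H1_elem elem_bubbles).
Proof.
move=> N0 al0; have pi0 := pi_gt0 R.
have p4 : 0 < (4 * pi)^-1 :> R by rewrite invr_gt0 mulr_gt0.
have lnZ : - (4 * N%:R) - ln 3 - ln e <=
    ln (sphere_mean (fun x => expR (2 * bubbles x))).
  have Z := sphere_int_expR_bubbles N0.
  apply: (@le_trans _ _ (ln (expR (- (4 * N%:R)) / (3 * e)))).
    rewrite ln_div ?posrE ?expR_gt0 ?mulr_gt0// expRK lnM ?posrE//; lra.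
  rewrite ler_ln ?posrE; last 2 first.
  - by rewrite divr_gt0 ?expR_gt0// mulr_gt0.
  - rewrite /sphere_mean mulr_gt0// (lt_le_trans _ Z)// mulr_gt0 ?expR_gt0//.
    by rewrite divr_gt0// mulr_gt0.
  rewrite /sphere_mean -ler_pdivrMl// invrK (le_trans _ Z)//.
  rewrite mulrCA ler_pM2l ?expR_gt0// ler_pM2l ?mulr_gt0//.
  by rewrite lef_pV2 ?posrE ?mulr_gt0//; exact: kappa_le.
have E : sphere_mean (fun x => dotv (sphere_grad bubbles x) (sphere_grad bubbles x)) <=
    N%:R * (2 * N%:R - ln e).
  by rewrite /sphere_mean ler_pdivrMl ?mulr_gt0// [leRHS]mulrC energy_bubbles.
have U : sphere_mean bubbles <= 2 * N%:R.
  by rewrite /sphere_mean ler_pdivrMl ?mulr_gt0// [leRHS]mulrC sphere_int_bubbles.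
have aE := ler_wpM2l (ltW al0) E.
by rewrite /J/=; lra.
Qed.

(* [e^(2u) |x_3^2 - l| <= e^u <= d e^(2u) + d^-1] *)
Lemma bubbles_concentration (l d : R) : (0 < N)%N -> 0 < d ->
  (forall x, dotv x x = 1 -> `|x ord0 j2 ^+ 2 - l| <= bubbles_prod x) ->
  `|sphere_int (fun x => x ord0 j2 ^+ 2 * expR (2 * bubbles x)) /
    sphere_int (fun x => expR (2 * bubbles x)) - l| <=
  d + 3 * e * expR (4 * N%:R) / d.
Proof.
pose w x := expR (2 * bubbles x); move=> N0 d0 Wl; have pi0 := pi_gt0 R.
have ew : elem w by exact: elem_expR_bubbles.
have ex : elem (fun x : 'rV[R]_3 => x ord0 j2 ^+ 2) by apply: elemX; exact: elem_coord.
have ed : elem (fun x => d * w x + d^-1).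
  by apply: elemD; [apply: elemM => //; exact: elem_cst|exact: elem_cst].
have el : elem (fun x : 'rV[R]_3 => (x ord0 j2 ^+ 2 - l) * w x).
  by apply: elemM => //; apply: elemB => //; exact: elem_cst.
have Zge : (expR (4 * N%:R))^-1 * (4 * pi / kappa) <= sphere_int w.
  by rewrite -expRN; exact: sphere_int_expR_bubbles.
set E := expR _ in Zge *; have E0 : 0 < E by exact: expR_gt0.
rewrite -/w; set Z := sphere_int w in Zge *.
have Z0 : 0 < Z.
  by rewrite (lt_le_trans _ Zge)// mulr_gt0 ?invr_gt0// divr_gt0// mulr_gt0.
have pw x : dotv x x = 1 -> `|(x ord0 j2 ^+ 2 - l) * w x| <= d * w x + d^-1.
  move=> x1; rewrite normrM /w expR_bubbles2; have := Wl x x1.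
  have := bubbles_prod_gt0 x; move: (bubbles_prod x) `|_ - l| => W q W0 qW.
  rewrite (@ger0_norm _ (W ^- 2)); last by rewrite invr_ge0 exprn_ge0// ltW.
  apply: (@le_trans _ _ W^-1).
    by rewrite ler_pdivrMr ?exprn_gt0// expr2 mulrA mulVf ?gt_eqF// mul1r.
  rewrite -exprVn; move: W^-1 => v.
  (* Here [v = e^u], and [v <= d v^2 + d^-1] follows by completing the square. *)
  rewrite -subr_ge0.
  have -> : d * v ^+ 2 + d^-1 - v = d^-1 * ((d * v - 2^-1) ^+ 2 + 3 / 4).
    by field; rewrite gt_eqF.
  by rewrite mulr_ge0 ?invr_ge0 ?(ltW d0)// addr_ge0// sqr_ge0.
have B : `|sphere_int (fun x => (x ord0 j2 ^+ 2 - l) * w x)| <= d * Z + d^-1 * (4 * pi).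
  have -> : d * Z + d^-1 * (4 * pi) = sphere_int (fun x => d * w x + d^-1).
    rewrite sphere_intD; [|by apply: elemM => //; exact: elem_cst|exact: elem_cst].
    by rewrite sphere_intZ// sphere_int_cst.
  rewrite ler_norml -sphere_intN//; apply/andP; split; apply: le_sphere_int => //.
  - exact: elemN.
  - by move=> x /pw; rewrite ler_norml => /andP[].
  - by move=> x /pw; rewrite ler_norml => /andP[].
have -> : sphere_int (fun x => x ord0 j2 ^+ 2 * w x) / Z - l =
    sphere_int (fun x => (x ord0 j2 ^+ 2 - l) * w x) / Z.
  have -> : sphere_int (fun x => (x ord0 j2 ^+ 2 - l) * w x) =
      sphere_int (fun x => x ord0 j2 ^+ 2 * w x) - l * Z.
    rewrite -sphere_intZ// -sphere_intB//; last 2 first.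
    - exact: elemM.
    - by apply: elemM => //; exact: elem_cst.
    by apply: eq_sphere_int => x _; rewrite mulrBl.
  by field; rewrite gt_eqF.
(* The lower bound on the mass absorbs the error [4 pi / d] into a multiple of [Z]. *)
have Z3 : 4 * pi <= 3 * e * E * Z.
  have -> : 4 * pi = kappa * E * (E^-1 * (4 * pi / kappa)) by field; rewrite !gt_eqF.
  apply: (@le_trans _ _ (kappa * E * Z)); first by rewrite ler_pM2l// mulr_gt0.
  by rewrite !ler_pM2r.
rewrite normrM normfV (gtr0_norm Z0) ler_pdivrMr//; apply: (le_trans B).
have -> : (d + 3 * e * E / d) * Z = d * Z + d^-1 * (3 * e * E * Z).
  by field; rewrite gt_eqF.
by rewrite lerD2l ler_pM2l ?invr_gt0.
Qed.

End bubbles.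

(** Everything about the configuration is reduced to invariance of the product under two symmetries
    and two pointwise lower bounds for it. The condition [alpha * N < 1] makes the coefficient of
    [ln (1 / e)] positive. *)
Lemma bubbles_sequence (R : realType) (N : nat) (a : 'I_N -> 'rV[R]_3)
    (l t alpha : R) :
  (0 < N)%N -> 0 < alpha -> alpha * N%:R < 1 ->
  (forall i, dotv (a i) (a i) = 1) ->
  0 <= t <= 2 * pi -> cos t = - 2^-1 ->
  (forall e x, bubbles_prod a e (reflect3 x) = bubbles_prod a e x) ->
  (forall e x, bubbles_prod a e (rotate3 t x) = bubbles_prod a e x) ->
  (forall (e : R) x, 0 < e -> dotv x x = 1 -> e <= bubbles_prod a e x) ->
  (forall (e : R) x, 0 < e -> dotv x x = 1 ->
    `|x ord0 j2 ^+ 2 - l| <= bubbles_prod a e x) ->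
  exists u : nat -> H1_sphere R,
    [/\ forall n, M1 (u n),
        J alpha (u n) @[n --> \oo] --> +oo &
        frobenius (Lambda (u n)) ^+ 2 @[n --> \oo] --> 3 / 2 * (l - 1 / 3) ^+ 2].
Proof.
move=> N0 al0 alN a1 t02 cost Wrefl Wrot Wge Wl.
pose d n : R := harmonic n.
have d0 n : 0 < d n by rewrite invr_gt0.
have d1 n : d n <= 1 by rewrite invf_le1// ler1n.
(* With [e = d^2] the concentration error [d + 3 e E / d], where [E = e^(4 N)] with the exponential
   base, is a constant times [d], hence tends to 0. *)
pose e n := d n ^+ 2.
have e0 n : 0 < e n by rewrite exprn_gt0.
have e1 n : e n <= 1 by rewrite exprn_ile1// ltW.
have erefl n x : bubbles a (e n) (reflect3 x) = bubbles a (e n) x.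
  by rewrite !bubblesE// Wrefl.
have erot n x : bubbles a (e n) (rotate3 t x) = bubbles a (e n) x.
  by rewrite !bubblesE// Wrot.
pose u n := H1_elem (elem_bubbles a (e0 n)).
have Wg n x := Wge _ x (e0 n).
exists u; split.
- by move=> n; exact: sym_M1 (erefl n) (erot n) t02 cost.
- apply/cvgryPge => A.
  set k := 1 - alpha * N%:R.
  have k0 : 0 < k by rewrite subr_gt0.
  near=> n.
  apply: le_trans (J_bubbles (e0 n) (e1 n) a1 (Wg n) N0 al0).
  set C := (_ + _ in X in _ <= X).
  rewrite lerBrDr.
  (* The lower bound becomes [2 k ln (n + 1)] minus a constant, which exceeds [A] once [n] is beyond
     an explicit exponential. *)
  have -> : - ln (e n) = 2 * ln (n.+1%:R : R).
    by rewrite /e lnXn// /d /= lnV ?posrE// mulr_natl mulNrn opprK.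
  rewrite -ler_pdivrMl// -ler_pdivrMl//.
  rewrite -ler_expR lnK ?posrE// -[n.+1%:R]nat1r.
  apply: (@le_trans _ _ n%:R); last by rewrite lerDr.
  by near: n; exact: nbhs_infty_ger.
have Zgt0 n : 0 < sphere_int (fun x => expR (2 * bubbles a (e n) x)).
  apply: lt_le_trans (sphere_int_expR_bubbles (e0 n) (e1 n) a1 N0).
  rewrite mulr_gt0 ?expR_gt0// divr_gt0 ?mulr_gt0 ?pi_gt0//.
  by rewrite addr_gt0 ?exprn_gt0// mulr_gt0.
under eq_fun => n do
  rewrite (sym_frobenius (elem_bubbles a (e0 n)) (erefl n) (erot n) t02 cost (Zgt0 n)).
apply: cvgM; first exact: cvg_cst.
suff H : sphere_int (fun x => x ord0 j2 ^+ 2 * expR (2 * bubbles a (e n) x)) /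
    sphere_int (fun x => expR (2 * bubbles a (e n) x)) @[n --> \oo] --> l.
  under eq_fun do rewrite expr2.
  by rewrite expr2; apply: cvgM; apply: cvgB => //; exact: cvg_cst.
apply/cvgrPdist_le => eps eps0.
pose K : R := 1 + 3 * expR (4 * N%:R).
have K0 : 0 < K by rewrite addr_gt0// mulr_gt0// expR_gt0.
near=> n.
rewrite distrC (le_trans (bubbles_concentration (e0 n) (e1 n) a1 N0 (d0 n) _))//.
  by move=> x x1; exact: Wl.
have -> : d n + 3 * e n * expR (4 * N%:R) / d n = K * d n.
  by rewrite /e /K; field; rewrite gt_eqF.
rewrite -ler_pdivlMl//.
have : `|0 - harmonic n| <= K^-1 * eps.
  near: n; apply: (cvgrPdist_le _ _).1; first exact: cvg_harmonic.
  by rewrite mulr_gt0// invr_gt0.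
by rewrite sub0r normrN ger0_norm// ltW// d0.
Unshelve. all: by end_near. Qed.

(** * The two configurations: equilateral triangle and poles *)

Section third_turn.
Context (R : realType).
Let t : R := 2 * pi / 3.

Lemma third_turn_itv : 0 <= t <= 2 * pi.
Proof. by have := pi_gt0 R; rewrite /t; lra. Qed.

(** With [c = cos t], the equation [cos (3 t) = 1] reads [4 c^3 - 3 c - 1 = (c - 1) (2 c + 1)^2 =
    0], and [c < 1] because [0 < t < pi]. *)
Lemma cos_third_turn : cos t = - 2^-1.
Proof.
have tp : 0 < t < pi by have := pi_gt0 R; rewrite /t; lra.
have c1 : cos t < 1.
  rewrite -cos0 ltr_cos ?in_itv/= ?lexx ?pi_ge0//; first by case/andP: tp.
  by case/andP: tp => /ltW -> /ltW ->.
have : cos (t + t + t) = 1.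
  have -> : t + t + t = pi *+ 2 by rewrite /t mulr2n; field.
  exact: cos2pi.
rewrite !cosD sinD => h.
have s2 := sin2cos2 t.
have : (cos t - 1) * (2 * cos t + 1) ^+ 2 = 0.
  transitivity (4 * cos t ^+ 3 - 3 * cos t - 1); first by ring.
  rewrite -[X in _ - X]h.
  transitivity (3 * cos t * (cos t ^+ 2 + sin t ^+ 2 - 1)); first by ring.
  by rewrite cos2Dsin2 subrr mulr0.
by move=> /eqP; rewrite mulf_eq0 subr_eq0 (lt_eqF c1)/= expf_eq0/= => /eqP; lra.
Qed.

Lemma sin_third_turn : sin t ^+ 2 = 3 / 4.
Proof. by rewrite sin2cos2 cos_third_turn; field. Qed.

(** The vertices lie on the equator at azimuths [0], [t] and [- t]. *)
Definition triangle (i : 'I_3) : 'rV[R]_3 :=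
  \row_(j < 3) [:: [:: 1; cos t; cos t]`_i; [:: 0; sin t; - sin t]`_i; 0]`_j.

Lemma triangle_unit i : dotv (triangle i) (triangle i) = 1.
Proof.
have := cos2Dsin2 t; case: i => [[|[|[|//]]] i3]; rewrite dotvE !mxE/= => h; last 2 first.
- by rewrite -h; ring.
- by rewrite -h; ring.
by ring.
Qed.

Lemma triangle_prodE e x : bubbles_prod triangle e x =
  bubble e (triangle j0) x * bubble e (triangle j1) x * bubble e (triangle j2) x.
Proof.
rewrite /bubbles_prod !big_ord_recl big_ord0 mulr1 mulrA.
by congr (bubble _ (triangle _) _ * bubble _ (triangle _) _ * bubble _ (triangle _) _);
  exact/val_inj.
Qed.

Lemma triangle_reflect e x :
  bubbles_prod triangle e (reflect3 x) = bubbles_prod triangle e x.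
Proof. by rewrite !triangle_prodE /bubble !dotvE !mxE/=; ring. Qed.

(** The rotation permutes the vertices cyclically, hence also the three factors. *)
Lemma triangle_rotate e x :
  bubbles_prod triangle e (rotate3 t x) = bubbles_prod triangle e x.
Proof.
rewrite !triangle_prodE.
have c := cos_third_turn; have s2 := sin_third_turn.
have E0 : bubble e (triangle j0) (rotate3 t x) = bubble e (triangle j2) x.
  rewrite /bubble !dotvE !mxE/= c; move: s2; move: (sin t) => s s2.
  apply/eqP; rewrite -subr_eq0; apply/eqP.
  (* Once [cos t = - 1 / 2] is substituted, the two sides differ by a multiple of [s^2 - 3 / 4]; the
     same holds for the other two factors. *)
  transitivity (2^-1 * (s ^+ 2 - 3 / 4) * (x ord0 j0 ^+ 2 + x ord0 j1 ^+ 2 - 1)); first by field.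
  by rewrite s2 subrr mulr0 mul0r.
have E1 : bubble e (triangle j1) (rotate3 t x) = bubble e (triangle j0) x.
  rewrite /bubble !dotvE !mxE/= c; move: s2; move: (sin t) => s s2.
  apply/eqP; rewrite -subr_eq0; apply/eqP.
  transitivity (2^-1 * (s ^+ 2 - 3 / 4) * ((x ord0 j0 - 1) ^+ 2 + x ord0 j1 ^+ 2)); first by field.
  by rewrite s2 subrr mulr0 mul0r.
have E2 : bubble e (triangle j2) (rotate3 t x) = bubble e (triangle j1) x.
  rewrite /bubble !dotvE !mxE/= c; move: s2; move: (sin t) => s s2.
  apply/eqP; rewrite -subr_eq0; apply/eqP.
  transitivity (2^-1 * (s ^+ 2 - 3 / 4) * (x ord0 j0 ^+ 2 + x ord0 j1 ^+ 2 + 2 * x ord0 j0)); first by field.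
  by rewrite s2 subrr mulr0 mul0r.
by rewrite E0 E1 E2; ring.
Qed.

(** With [z = x0 + i x1], the three numbers [x . a_i] are the roots of
    [T^3 - (3 / 4) |z|^2 T - Re (z^3) / 4], here evaluated at [T = 1 + e]. *)
Lemma triangle_prod_sphere e x : dotv x x = 1 -> bubbles_prod triangle e x =
  (1 + e) ^+ 3 - 3 / 4 * (1 + e) * (x ord0 j0 ^+ 2 + x ord0 j1 ^+ 2) -
  4^-1 * (x ord0 j0 ^+ 3 - 3 * x ord0 j0 * x ord0 j1 ^+ 2).
Proof.
move=> x1; rewrite triangle_prodE !bubble_sphere ?triangle_unit// !dotvE !mxE/=.
rewrite cos_third_turn; have s2 := sin_third_turn.
move: (sin t) s2 => s s2.
apply/eqP; rewrite -subr_eq0; apply/eqP.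
transitivity ((3 / 4 - s ^+ 2) * x ord0 j1 ^+ 2 * (1 + e - x ord0 j0)); first by field.
by rewrite s2 subrr !mul0r.
Qed.

(* [x0^3 - 3 x0 x1^2] is the real part of [(x0 + i x1)^3]. *)
Lemma re_cube_le (p q : R) : p ^+ 2 + q ^+ 2 <= 1 ->
  p ^+ 3 - 3 * p * q ^+ 2 <= p ^+ 2 + q ^+ 2.
Proof.
move=> h; have r0 : 0 <= p ^+ 2 + q ^+ 2 by rewrite addr_ge0 ?sqr_ge0.
have [//|c0] := leP (p ^+ 3 - 3 * p * q ^+ 2) (p ^+ 2 + q ^+ 2).
have : (p ^+ 3 - 3 * p * q ^+ 2) ^+ 2 <= (p ^+ 2 + q ^+ 2) ^+ 2.
  apply: (@le_trans _ _ ((p ^+ 2 + q ^+ 2) ^+ 3)).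
    (* The difference is the square of the imaginary part of the cube. *)
    rewrite -subr_ge0; have -> : (p ^+ 2 + q ^+ 2) ^+ 3 -
      (p ^+ 3 - 3 * p * q ^+ 2) ^+ 2 = (3 * p ^+ 2 * q - q ^+ 3) ^+ 2 by ring.
    exact: sqr_ge0.
  by rewrite exprS ler_piMl// exprn_ge0.
rewrite ler_sqr ?nnegrE//; last by rewrite ltW// (le_lt_trans r0).
by rewrite leNgt c0.
Qed.

Let sphere_xy (x : 'rV[R]_3) : dotv x x = 1 ->
  x ord0 j0 ^+ 2 + x ord0 j1 ^+ 2 = 1 - x ord0 j2 ^+ 2.
Proof. by rewrite dotvE => <-; ring. Qed.

(** With [r = x0^2 + x1^2 <= 1] and the real part of the cube at most [r], the product is at least
    [(1 + e)^3 - r - 3 e r / 4 >= 1 - r], which is the squared height. *)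
Lemma triangle_prod_ge_height e x : 0 < e -> dotv x x = 1 ->
  `|x ord0 j2 ^+ 2 - 0| <= bubbles_prod triangle e x.
Proof.
move=> e0 x1; rewrite subr0 ger0_norm ?sqr_ge0// triangle_prod_sphere//.
have xy := sphere_xy x1.
have : x ord0 j0 ^+ 2 + x ord0 j1 ^+ 2 <= 1 by rewrite xy gerBl sqr_ge0.
move=> r1; have := re_cube_le r1.
have r0 : 0 <= x ord0 j0 ^+ 2 + x ord0 j1 ^+ 2 by rewrite addr_ge0 ?sqr_ge0.
move: (x ord0 j0 ^+ 3 - _) => k.
have -> : x ord0 j2 ^+ 2 = 1 - (x ord0 j0 ^+ 2 + x ord0 j1 ^+ 2) by rewrite xy; ring.
move: (x ord0 j0 ^+ 2 + x ord0 j1 ^+ 2) r0 r1 => r r0 r1 kr.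
have er : e * r <= e by rewrite ger_pMr.
have e3 : 1 + 3 * e <= (1 + e) ^+ 3.
  rewrite -subr_ge0; have -> : (1 + e) ^+ 3 - (1 + 3 * e) = e ^+ 2 * (3 + e) by ring.
  by rewrite mulr_ge0 ?sqr_ge0// addr_ge0// ltW.
by lra.
Qed.

(** The same estimate with [r <= 1] leaves at least [3 e - 3 e / 4 >= e]. *)
Lemma triangle_prod_ge e x : 0 < e -> dotv x x = 1 -> e <= bubbles_prod triangle e x.
Proof.
move=> e0 x1; rewrite triangle_prod_sphere//.
have xy := sphere_xy x1.
have : x ord0 j0 ^+ 2 + x ord0 j1 ^+ 2 <= 1 by rewrite xy gerBl sqr_ge0.
move=> r1; have := re_cube_le r1.
have r0 : 0 <= x ord0 j0 ^+ 2 + x ord0 j1 ^+ 2 by rewrite addr_ge0 ?sqr_ge0.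
move: (x ord0 j0 ^+ 3 - _) => k.
move: (x ord0 j0 ^+ 2 + x ord0 j1 ^+ 2) r0 r1 => r r0 r1 kr.
have er : e * r <= e by rewrite ger_pMr.
have e3 : 1 + 3 * e <= (1 + e) ^+ 3.
  rewrite -subr_ge0; have -> : (1 + e) ^+ 3 - (1 + 3 * e) = e ^+ 2 * (3 + e) by ring.
  by rewrite mulr_ge0 ?sqr_ge0// addr_ge0// ltW.
by lra.
Qed.

Definition poles (i : 'I_2) : 'rV[R]_3 := \row_(j < 3) [:: 0; 0; (-1) ^+ i]`_j.

Lemma poles_unit i : dotv (poles i) (poles i) = 1.
Proof.
by case: i => [[|[|//]] i2]; rewrite dotvE !mxE/= ?expr0 ?expr1; ring.
Qed.

Lemma poles_prodE e x : bubbles_prod poles e x =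
  bubble e (poles ord0) x * bubble e (poles ord_max) x.
Proof. by rewrite /bubbles_prod big_ord_recr big_ord1/=; congr (bubble _ (poles _) _ * _); exact/val_inj. Qed.

Lemma poles_reflect e x : bubbles_prod poles e (reflect3 x) = bubbles_prod poles e x.
Proof. by rewrite !poles_prodE /bubble !dotvE !mxE/= expr0 expr1; ring. Qed.

Lemma poles_rotate e x : bubbles_prod poles e (rotate3 t x) = bubbles_prod poles e x.
Proof.
have E i : bubble e (poles i) (rotate3 t x) = bubble e (poles i) x.
  rewrite /bubble !dotvE !mxE/=; congr (_ + _ * (_ + _)).
  have := cos2Dsin2 t; move: (cos t) (sin t) => c s h.
  transitivity ((c ^+ 2 + s ^+ 2) * (x ord0 j0 ^+ 2 + x ord0 j1 ^+ 2)); first by ring.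
  by rewrite h; ring.
by rewrite !poles_prodE !E.
Qed.

Lemma poles_prod_sphere e x : dotv x x = 1 -> bubbles_prod poles e x =
  (1 + e) ^+ 2 - x ord0 j2 ^+ 2.
Proof.
move=> x1; rewrite poles_prodE !bubble_sphere ?poles_unit// !dotvE !mxE/= expr0 expr1.
ring.
Qed.

Let height_le1 (x : 'rV[R]_3) : dotv x x = 1 -> x ord0 j2 ^+ 2 <= 1.
Proof. by move=> /sphere_xy h; rewrite -subr_ge0 -h addr_ge0 ?sqr_ge0. Qed.

Lemma poles_prod_ge_height e x : 0 < e -> dotv x x = 1 ->
  `|x ord0 j2 ^+ 2 - 1| <= bubbles_prod poles e x.
Proof.
move=> e0 x1; rewrite poles_prod_sphere// ler0_norm ?subr_le0 ?height_le1//.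
by rewrite opprB lerB// exprn_ege1// lerDl ltW.
Qed.

Lemma poles_prod_ge e x : 0 < e -> dotv x x = 1 -> e <= bubbles_prod poles e x.
Proof.
move=> e0 x1; rewrite poles_prod_sphere//; have := height_le1 x1.
by have := sqr_ge0 e; lra.
Qed.

End third_turn.

(** * Conclusion for both ranges of alpha *)

Theorem proposition2p4 (R : realType) :
  (forall alpha : R, 1 / 3 < alpha < 1 / 2 ->
     exists u : nat -> H1_sphere R,
       [/\ forall n, M1 (u n),
           J alpha (u n) @[n --> \oo] --> +oo &
           frobenius (Lambda (u n)) ^+ 2 @[n --> \oo] --> (2 / 3 : R)])
  /\
  (forall alpha : R, 1 / 4 < alpha < 1 / 3 ->
     exists u : nat -> H1_sphere R,
       [/\ forall n, M1 (u n),
           J alpha (u n) @[n --> \oo] --> +oo &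
           frobenius (Lambda (u n)) ^+ 2 @[n --> \oo] --> (1 / 6 : R)]).
Proof.
split=> alpha /andP[al1 al2].
(* Poles: [N = 2] and [l = 1]; the condition [alpha * N < 1] is [alpha < 1 / 2]. *)
- have -> : 2 / 3 = 3 / 2 * (1 - 1 / 3) ^+ 2 :> R by field.
  apply: (@bubbles_sequence R 2 (@poles R) 1 (2 * pi / 3)) => //; try lra.
  + exact: poles_unit.
  + exact: third_turn_itv.
  + exact: cos_third_turn.
  + exact: poles_reflect.
  + exact: poles_rotate.
  + exact: poles_prod_ge.
  + exact: poles_prod_ge_height.
(* Triangle: [N = 3] and [l = 0], as the mass concentrates on the equator; the condition is
   [alpha < 1 / 3]. *)
- have -> : 1 / 6 = 3 / 2 * (0 - 1 / 3) ^+ 2 :> R by field.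
  apply: (@bubbles_sequence R 3 (@triangle R) 0 (2 * pi / 3)) => //; try lra.
  + exact: triangle_unit.
  + exact: third_turn_itv.
  + exact: cos_third_turn.
  + exact: triangle_reflect.
  + exact: triangle_rotate.
  + exact: triangle_prod_ge.
  + exact: triangle_prod_ge_height.
Qed.
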